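(* For $0<|q|<1$, \begin{align*} \sum_{n=0}^{\infty}\frac{q^{n}(-q^3;q^2)_n(q;q)_n}{(q^3;q^2)_n(-q^2;q)_n}&=\frac{1}{2}\left(1-\frac{1}{q}\right)\frac{(q;q)_{\infty}^{2}}{(-q;q)_{\infty}^{2}}\sum_{n=0}^{\infty}\frac{(-1;q)_n(-q;q^2)_n}{(q;q^2)_n(q;q)_n}q^n\\ &\quad+\frac{1}{q}\frac{(-q;q^2)_{\infty}}{(q^3;q^2)_{\infty}}\sum_{n=0}^{\infty}\frac{(q;q^2)_n(-q)^n}{(-q;q^2)_{n}(1+q^{2n})}p_{2n}(-1;q^{-2n-1},-1:q). \end{align*} Consequently, \begin{align*} \sum_{n=1}^{\infty}\overline{p}_{\omega}(n)q^n&=-\frac{1}{2}\frac{(q;q)_{\infty}(q;q^2)_{\infty}}{(-q;q)_{\infty}(-q;q^2)_{\infty}}\sum_{n=0}^{\infty}\frac{(-1;q)_n(-q;q^2)_n}{(q;q^2)_n(q;q)_n}q^n\\ &\quad+\frac{(-q;q)_{\infty}}{(q;q)_{\infty}}\sum_{n=0}^{\infty}\frac{(q;q^2)_n(-q)^n}{(-q;q^2)_{n}(1+q^{2n})}p_{2n}(-1;q^{-2n-1},-1:q). \end{align*}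
   Context: $(a;q)_n=\prod_{j=0}^{n-1}(1-aq^j)$, $(a;q)_\infty=\prod_{j\ge0}(1-aq^j)$. The little $q$-Jacobi polynomial is $p_n(x;a,b:q)={}_{2}\phi_{1}\left(\begin{matrix}q^{-n},& abq^{n+1}\\ &aq\end{matrix};q,qx\right)=\sum_{k\ge0}\frac{(q^{-n};q)_k(abq^{n+1};q)_k}{(q;q)_k(aq;q)_k}(qx)^k$. An overpartition of $n$ is a partition of $n$ in which the first occurrence of each distinct part may be overlined. $\overline{p}_{\omega}(n)$ denotes the number of overpartitions of $n$ in which the smallest part is overlined and all odd parts are less than twice the smallest part; equivalently $\sum_{n\ge1}\overline{p}_{\omega}(n)q^n=\sum_{n\ge1}\frac{q^n(-q^{n+1};q)_n(-q^{2n+2};q^2)_{\infty}}{(1-q^n)(q^{n+1};q)_n(q^{2n+2};q^2)_{\infty}}$. *)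

(* Defs.v *)
From Stdlib Require Import Reals.
From Coquelicot Require Import Coquelicot.

Open Scope C_scope.

Fixpoint qpoch (a q : C) (n : nat) : C :=
  match n with
  | O => 1
  | S m => qpoch a q m * (1 - a * q ^ m)
  end.

Definition is_qpoch_inf (a q l : C) : Prop :=
  filterlim (fun n => qpoch a q n) eventually (locally l).

(* little q-Jacobi polynomial p_N(x;a,b:q) = 2phi1(q^{-N}, abq^{N+1}; aq; q, qx).
   The series terminates: (q^{-N};q)_k = 0 for k > N, so it is the sum over
   k = 0..N (sum_n f N = f 0 + ... + f N). *)
Definition little_qJacobi (N : nat) (x a b q : C) : C :=
  sum_n (fun k =>
    qpoch (/ q ^ N) q k * qpoch (a * b * q ^ (S N)) q k
    / (qpoch q q k * qpoch (a * q) q k) * (q * x) ^ k) N.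

Close Scope C_scope.

From mathcomp Require Import all_boot.

(* An overpartition of n is encoded by a multiplicity function m (m i = number
   of parts equal to i, for parts 1..n; m 0 = 0) and the set S of part values
   whose first occurrence is overlined (S a subset of the parts occurring).
   pbar_omega n counts those with the smallest part overlined and every odd
   part less than twice the smallest part. *)
Definition is_pbar_omega (n : nat) (m : {ffun 'I_n.+1 -> 'I_n.+1})
    (S : {set 'I_n.+1}) : bool :=
  [&& (\sum_(i < n.+1) (i : nat) * (m i : nat) == n)%N,
      (m ord0 : nat) == 0%N,
      S \subset [set i | (0 < m i)%N] &
      [exists s : 'I_n.+1,
        [&& (0 < m s)%N, s \in S,
            [forall i : 'I_n.+1, (0 < m i)%N ==> ((s : nat) <= i)%N] &
            [forall i : 'I_n.+1, ((0 < m i)%N && odd i) ==> ((i : nat) < 2 * s)%N]]]].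

Definition pbar_omega (n : nat) : nat :=
  #|[set p : {ffun 'I_n.+1 -> 'I_n.+1} * {set 'I_n.+1} | @is_pbar_omega n p.1 p.2]|.

(* Main.v *)
(** The quotient (-q;q^2)_n / (q;q^2)_n is, by the q-binomial theorem in base q^2,
    a constant times sum_m c_m (-q)^m q^(2nm) with
    c_m = (-1;q^2)_m / (q^2;q^2)_m.  Inserting this in both non-Jacobi series and
    exchanging summations, the second one becomes a sum over m of q-binomial
    sums, and the first one a sum of c_m (-q)^m B_(2m), where
    B_N = sum_(n >= 1) (q;q)_(n-1) / (-q;q)_n q^(n(N+1)).  Telescoping gives
    (1 + q^N) B_N + (1 - q^N) B_(N-1) = q^N, so that
    2 (-1)^N (-q;q)_N / (q;q)_N B_N is a partial sum of
    sum_k (-1;q)_k / (q;q)_k (-q)^k minus its full value (q;q)_oo / (-q;q)_oo.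
    For N = 2m that partial sum is exactly the little q-Jacobi polynomial in the
    theorem, because its factors (q^(-2m);q)_k cancel.

    For the overpartitions, generating functions of configurations with parts
    and multiplicities at most N are finite products; both these products and
    their coefficients converge under a geometric majorant, and comparing the
    two limits gives the generating function. *)

Require Import Defs.
From HB Require Import structures.
From mathcomp Require all_boot zify.
From Stdlib Require Import Reals Lra Lia Arith IndefiniteDescription.
From Coquelicot Require Import Coquelicot.

Set Bullet Behavior "Strict Subproofs".
Open Scope C_scope.

(** * Limits and series *)

Definition Clim (u : nat -> C) (l : C) : Prop :=
  filterlim u eventually (locally l).

Lemma Clim_eps (u : nat -> C) (l : C) :
  Clim u l <->
  (forall eps : R, (0 < eps)%R ->
     exists N, forall n, (N <= n)%nat -> (Cmod (u n - l) < eps)%R).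
Proof.
split.
- intros H eps He.
  exact (proj1 (@filterlim_locally_ball_norm C_AbsRing nat C_NormedModule
           eventually _ u l) H (mkposreal eps He)).
- intros H.
  apply (@filterlim_locally_ball_norm C_AbsRing nat C_NormedModule
           eventually _ u l).
  intros eps. exact (H eps (cond_pos eps)).
Qed.

Lemma Clim_ext (u v : nat -> C) (l : C) :
  (forall n, u n = v n) -> Clim u l -> Clim v l.
Proof. intros H. apply filterlim_ext. exact H. Qed.

Lemma Clim_const (c : C) : Clim (fun _ => c) c.
Proof. apply filterlim_const. Qed.

Lemma Clim_unique (u : nat -> C) (l l' : C) : Clim u l -> Clim u l' -> l = l'.
Proof.
exact (@filterlim_locally_unique nat C_AbsRing C_NormedModule eventually _ u l l').
Qed.

Lemma Clim_plus (u v : nat -> C) (a b : C) :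
  Clim u a -> Clim v b -> Clim (fun n => u n + v n) (a + b).
Proof.
intros Hu Hv.
exact (filterlim_comp_2 _ _ _ Hu Hv
         (@filterlim_plus C_AbsRing C_NormedModule a b)).
Qed.

Lemma Clim_mult (u v : nat -> C) (a b : C) :
  Clim u a -> Clim v b -> Clim (fun n => u n * v n) (a * b).
Proof.
intros Hu Hv.
apply (filterlim_comp_2 _ _ Cmult Hu Hv).
(* [locally_C] passes between the two uniform structures on [C]: [filterlim_mult] is stated for the
   one of the absolute ring. *)
intros P HP. apply locally_C in HP.
destruct (@filterlim_mult C_AbsRing a b P HP) as [Q S HQ HS HQS].
exists Q S; [now apply locally_C|now apply locally_C|exact HQS].
Qed.

Lemma Clim_subseq (u : nat -> C) (l : C) (phi : nat -> nat) :
  (forall n, (n <= phi n)%nat) -> Clim u l -> Clim (fun n => u (phi n)) l.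
Proof.
intros Hphi Hu. apply (filterlim_comp _ _ _ phi u _ eventually); [|exact Hu].
intros P [N HN]. exists N. intros n Hn. apply HN.
specialize (Hphi n). lia.
Qed.

Lemma Clim_eventually_ext (u v : nat -> C) (l : C) (N : nat) :
  (forall n, (N <= n)%nat -> u n = v n) -> Clim u l -> Clim v l.
Proof.
intros H. apply filterlim_ext_loc. exists N. exact H.
Qed.

Lemma Clim_bound (u : nat -> C) (l : C) (K : R) :
  (forall n, (Cmod (u n) <= K)%R) -> Clim u l -> (Cmod l <= K)%R.
Proof.
intros H Hu. apply Rnot_lt_le. intros Hlt.
destruct (proj1 (Clim_eps u l) Hu (Cmod l - K)%R ltac:(lra)) as [N HN].
specialize (HN N (le_n _)). specialize (H N).
assert (Ht := Cmod_triangle (u N) (l - u N)).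
replace (u N + (l - u N)) with l in Ht by ring.
replace (u N - l) with (- (l - u N)) in HN by ring.
rewrite Cmod_opp in HN. lra.
Qed.

Lemma Clim_bounded (u : nat -> C) (l : C) :
  Clim u l -> exists K, (0 < K)%R /\ forall n, (Cmod (u n) <= K)%R.
Proof.
intros Hu.
destruct (proj1 (Clim_eps u l) Hu 1%R Rlt_0_1) as [N HN].
assert (HM : exists M, forall n, (n < N)%nat -> (Cmod (u n) <= M)%R).
{ clear HN. induction N as [|N [M IH]].
  - exists 0%R. intros n Hn. lia.
  - exists (Rmax M (Cmod (u N))). intros n Hn.
    destruct (Nat.eq_dec n N) as [->|Hne]; [apply Rmax_r|].
    apply Rle_trans with M; [apply IH; lia|apply Rmax_l]. }
destruct HM as [M HM].
assert (Hl := Cmod_ge_0 l).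
exists (Rmax M (Cmod l + 1)).
split; [apply Rlt_le_trans with (2 := Rmax_r _ _); lra|].
intros n. destruct (le_lt_dec N n) as [Hn|Hn].
- apply Rle_trans with (2 := Rmax_r _ _).
  specialize (HN n Hn). assert (Ht := Cmod_triangle (u n - l) l).
  replace (u n - l + l) with (u n) in Ht by ring. lra.
- apply Rle_trans with (2 := Rmax_l _ _). apply HM, Hn.
Qed.

Lemma Clim_pow0 (z : C) : (Cmod z < 1)%R -> Clim (fun n => z ^ n) 0.
Proof.
intros Hz. apply Clim_eps. intros eps He.
destruct (pow_lt_1_zero (Cmod z)) with (y := eps) as [N HN]; trivial.
{ rewrite Rabs_pos_eq; [exact Hz|apply Cmod_ge_0]. }
exists N. intros n Hn. replace (z ^ n - 0) with (z ^ n) by ring.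
rewrite Cmod_pow. specialize (HN n Hn).
rewrite Rabs_pos_eq in HN; [exact HN|]. apply pow_le, Cmod_ge_0.
Qed.

(** * Complex series and geometric majorants *)

Lemma is_series_Ceq (a b : nat -> C) (l m : C) :
  (forall n, a n = b n) -> l = m -> is_series a l -> is_series b m.
Proof. intros H <-. apply is_series_ext. exact H. Qed.

Lemma is_series_Cscal (c : C) (a : nat -> C) (l : C) :
  is_series a l -> is_series (fun n => c * a n) (c * l).
Proof. exact (@is_series_scal C_AbsRing C_NormedModule c a l). Qed.

Lemma is_series_Cplus (a b : nat -> C) (l m : C) :
  is_series a l -> is_series b m -> is_series (fun n => a n + b n) (l + m).
Proof. exact (@is_series_plus C_AbsRing C_NormedModule a b l m). Qed.

Lemma is_series_Cunique (a : nat -> C) (l m : C) :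
  is_series a l -> is_series a m -> l = m.
Proof. apply Clim_unique. Qed.

Lemma is_series_Cshift (a : nat -> C) (l : C) :
  is_series a l <-> is_series (fun n => a (S n)) (l - a O).
Proof.
split; intros H.
- apply (@is_series_incr_1 C_AbsRing C_NormedModule).
  change (is_series a (l - a O + a O)).
  replace (l - a O + a O) with l by ring. exact H.
- apply (@is_series_decr_1 C_AbsRing C_NormedModule). exact H.
Qed.

Lemma is_series_geom_R (K r : R) :
  (0 <= r < 1)%R -> is_series (fun n => K * r ^ n)%R (K / (1 - r))%R.
Proof.
intros Hr. apply (@is_series_scal R_AbsRing R_NormedModule K).
apply is_series_geom. rewrite Rabs_pos_eq; lra.
Qed.

Lemma ex_series_dominated (a : nat -> C) (K r : R) :
  (0 <= r < 1)%R -> (forall n, (Cmod (a n) <= K * r ^ n)%R) ->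
  exists l : C, is_series a l.
Proof.
intros Hr H.
apply (@ex_series_le C_AbsRing C_CompleteNormedModule a
         (fun n => K * r ^ n)%R); [exact H|].
eexists. apply is_series_geom_R, Hr.
Qed.

Lemma Cmod_sum_n_geom (a : nat -> C) (K r : R) (n : nat) :
  (0 <= r < 1)%R -> (forall i, (Cmod (a i) <= K * r ^ i)%R) ->
  (Cmod (sum_n a n) <= K / (1 - r))%R.
Proof.
intros Hr H.
assert (HK : (0 <= K)%R).
{ specialize (H O). simpl in H. assert (Hc := Cmod_ge_0 (a O)). lra. }
(* The induction needs the exact finite geometric sum; the final bound alone does not survive adding
   a term. *)
assert (Hs : (Cmod (sum_n a n) <= K * ((1 - r ^ S n) / (1 - r)))%R).
{ induction n as [|n IH].
  - rewrite sum_O. specialize (H O). simpl in *.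
    replace (K * ((1 - r * 1) / (1 - r)))%R with (K * 1)%R; [exact H|field; lra].
  - rewrite sum_Sn. eapply Rle_trans; [apply Cmod_triangle|].
    specialize (H (S n)).
    replace (K * ((1 - r ^ S (S n)) / (1 - r)))%R
      with (K * ((1 - r ^ S n) / (1 - r)) + K * r ^ S n)%R; [lra|].
    simpl. field. lra. }
eapply Rle_trans; [exact Hs|]. unfold Rdiv.
apply Rmult_le_compat_l; [exact HK|].
rewrite <- (Rmult_1_l (/ (1 - r))) at 2.
apply Rmult_le_compat_r; [apply Rlt_le, Rinv_0_lt_compat; lra|].
assert (Hp := pow_le r (S n) ltac:(lra)). lra.
Qed.

Lemma series_tail_geom (a : nat -> C) (l : C) (K r : R) (n : nat) :
  (0 <= r < 1)%R -> (forall i, (Cmod (a i) <= K * r ^ i)%R) -> is_series a l ->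
  (Cmod (l - sum_n a n) <= K * r ^ S n / (1 - r))%R.
Proof.
intros Hr H Hl.
apply Clim_bound with (u := fun k => sum_n (fun i => a (S n + i)%nat) k).
- intros k. apply Cmod_sum_n_geom; [exact Hr|].
  intros i. rewrite Rmult_assoc, <- pow_add. apply H.
(* The remainder is the sum of the shifted series, obtained by removing one term per induction
   step. *)
- change (is_series (fun i => a (S n + i)%nat) (l - sum_n a n)).
  revert l Hl. induction n as [|n IH]; intros l Hl.
  + rewrite sum_O. exact (proj1 (is_series_Cshift a l) Hl).
  + rewrite sum_Sn.
    assert (H1 := proj1 (is_series_Cshift _ _) (IH l Hl)). simpl in H1.
    eapply is_series_Ceq; [| |exact H1].
    * intros i. simpl. f_equal. lia.
    * rewrite Nat.add_0_r.
      change (plus (sum_n a n) (a (S n))) with (sum_n a n + a (S n)).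
      simpl. ring.
Qed.

(** * Tannery's theorem and exchange of double sums *)

Lemma Clim_sum_n (a : nat -> nat -> C) (b : nat -> C) (n : nat) :
  (forall i, Clim (fun N => a N i) (b i)) ->
  Clim (fun N => sum_n (a N) n) (sum_n b n).
Proof.
intros H. induction n as [|n IH].
- rewrite sum_O. apply Clim_ext with (2 := H O). intros N.
  now rewrite sum_O.
- rewrite sum_Sn. eapply Clim_ext; [|exact (Clim_plus _ _ _ _ IH (H (S n)))].
  intros N. now rewrite sum_Sn.
Qed.

(** Dominated convergence for series: a finite head converges column by column, and the common
    geometric majorant makes the tails of the rows and of the limit series uniformly small. *)
Lemma tannery (a : nat -> nat -> C) (b s : nat -> C) (K r : R) :
  (0 <= r < 1)%R ->
  (forall N i, (Cmod (a N i) <= K * r ^ i)%R) ->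
  (forall i, Clim (fun N => a N i) (b i)) ->
  (forall N, is_series (a N) (s N)) ->
  exists l : C, is_series b l /\ Clim s l.
Proof.
intros Hr Ha Hab Hs.
assert (Hb : forall i, (Cmod (b i) <= K * r ^ i)%R).
{ intros i. apply (Clim_bound (fun N => a N i)); [|apply Hab].
  intros N. apply Ha. }
destruct (ex_series_dominated b K r Hr Hb) as [l Hl].
exists l. split; [exact Hl|].
apply Clim_eps. intros eps He.
assert (HK : (0 <= K)%R).
{ specialize (Ha O O). simpl in Ha. assert (Hc := Cmod_ge_0 (a O O)). lra. }
(* This threshold for powers of [r] makes the tails at most eps/3; [K + 1] in place of [K] keeps the
   division legitimate when [K] is 0. *)
assert (Hd : (0 < eps / 3 * (1 - r) / (K + 1))%R).
{ apply Rdiv_lt_0_compat; [|lra]. apply Rmult_lt_0_compat; lra. }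
destruct (pow_lt_1_zero r) with (2 := Hd) as [M HM].
{ rewrite Rabs_pos_eq; lra. }
assert (Hp := pow_le r (S M) ltac:(lra)).
assert (Htail : (K * r ^ S M / (1 - r) <= eps / 3)%R).
{ specialize (HM (S M) ltac:(lia)). rewrite Rabs_pos_eq in HM by exact Hp.
  apply Rmult_le_reg_r with (1 - r)%R; [lra|].
  unfold Rdiv at 1. rewrite Rmult_assoc, Rinv_l, Rmult_1_r by lra.
  apply Rle_trans with ((K + 1) * r ^ S M)%R; [nra|].
  apply Rmult_le_reg_l with (/ (K + 1))%R; [apply Rinv_0_lt_compat; lra|].
  rewrite <- Rmult_assoc, Rinv_l, Rmult_1_l by lra.
  apply Rlt_le. rewrite Rmult_comm. exact HM. }
destruct (proj1 (Clim_eps _ _) (Clim_sum_n a b M Hab) (eps / 3)%R ltac:(lra))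
  as [N0 HN].
exists N0. intros N Hn. specialize (HN N Hn).
assert (H1 := series_tail_geom (a N) (s N) K r M Hr (Ha N) (Hs N)).
assert (H2 := series_tail_geom b l K r M Hr Hb Hl).
replace (s N - l) with ((s N - sum_n (a N) M)
  + ((sum_n (a N) M - sum_n b M) + - (l - sum_n b M))) by ring.
eapply Rle_lt_trans; [apply Cmod_triangle|].
assert (H3 := Cmod_triangle (sum_n (a N) M - sum_n b M) (- (l - sum_n b M))).
rewrite Cmod_opp in H3. lra.
Qed.

Lemma is_series_truncate (a : nat -> C) (n : nat) :
  is_series (fun i => if le_dec i n then a i else RtoC 0) (sum_n a n).
Proof.
apply Clim_eventually_ext with (u := fun _ => sum_n a n) (N := n);
  [|apply Clim_const].
intros k Hk. induction Hk as [|k Hk IH].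
- apply sum_n_ext_loc. intros i Hi. destruct (le_dec i n); [easy|lia].
- rewrite sum_Sn, <- IH. destruct (le_dec (S k) n); [lia|].
  symmetry. apply (@plus_zero_r C_AbelianMonoid).
Qed.

(** Each finite row is padded with zeros to a series; [N <= phi N] ensures that the padding
    eventually leaves every fixed column. *)
Lemma tannery_sum (a : nat -> nat -> C) (b : nat -> C) (phi : nat -> nat)
    (K r : R) :
  (0 <= r < 1)%R -> (forall N, (N <= phi N)%nat) ->
  (forall N i, (i <= phi N)%nat -> (Cmod (a N i) <= K * r ^ i)%R) ->
  (forall i, Clim (fun N => a N i) (b i)) ->
  exists l : C, is_series b l /\ Clim (fun N => sum_n (a N) (phi N)) l.
Proof.
intros Hr Hphi Ha Hab.
assert (HK : (0 <= K)%R).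
{ specialize (Ha O O ltac:(lia)). simpl in Ha.
  assert (Hc := Cmod_ge_0 (a O O)). lra. }
apply (tannery (fun N i => if le_dec i (phi N) then a N i else 0) b _ K r Hr).
- intros N i. destruct (le_dec i (phi N)); [now apply Ha|].
  rewrite Cmod_0. apply Rmult_le_pos; [exact HK|apply pow_le; lra].
- intros i. apply Clim_eventually_ext with (2 := Hab i) (N := i).
  intros n Hn. specialize (Hphi n). destruct (le_dec i (phi n)); [easy|lia].
- intros N. apply is_series_truncate.
Qed.

(** Both iterated sums are limits of the same square partial sums: Tannery is applied to the array
    and to its transpose, and finite sums commute. *)
Lemma series_fubini (x : nat -> nat -> C) (R1 T : nat -> C) (K r : R) :
  (0 <= r < 1)%R ->
  (forall n m, (Cmod (x n m) <= K * r ^ n * r ^ m)%R) ->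
  (forall n, is_series (fun m => x n m) (T n)) ->
  (forall m, is_series (fun n => x n m) (R1 m)) ->
  exists l : C, is_series T l /\ is_series R1 l.
Proof.
intros Hr Hx HT HR.
assert (Hsq : forall y : nat -> nat -> C, forall U : nat -> C,
  (forall n m, (Cmod (y n m) <= K * r ^ n * r ^ m)%R) ->
  (forall n, is_series (fun m => y n m) (U n)) ->
  exists l : C, is_series U l /\
    Clim (fun N => sum_n (fun n => sum_n (fun m => y n m) N) N) l).
{ intros y U Hy HU.
  apply (tannery_sum (fun N n => sum_n (fun m => y n m) N) U (fun N => N)
           (K / (1 - r)) r Hr).
  - intros N. lia.
  - intros N n _.
    replace (K / (1 - r) * r ^ n)%R with (K * r ^ n / (1 - r))%R
      by (field; lra).
    apply Cmod_sum_n_geom; [exact Hr|apply Hy].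
  - exact HU. }
destruct (Hsq x T Hx HT) as [l [Hl1 Hl2]].
destruct (Hsq (fun m n => x n m) R1) as [l' [Hl1' Hl2']].
{ intros m n. eapply Rle_trans; [apply Hx|]. apply Req_le. ring. }
{ exact HR. }
exists l. split; [exact Hl1|].
replace l with l'; [exact Hl1'|].
apply (Clim_unique _ _ _ Hl2').
eapply Clim_ext; [|exact Hl2]. intros N. apply (@sum_n_switch C_AbelianMonoid).
Qed.

(** * Infinite products *)

Fixpoint cprod (f : nat -> C) (n : nat) : C :=
  match n with O => 1 | S m => cprod f m * f m end.

Lemma Clim_cprod (f : nat -> nat -> C) (g : nat -> C) (n : nat) :
  (forall i, Clim (fun N => f N i) (g i)) ->
  Clim (fun N => cprod (f N) n) (cprod g n).
Proof.
intros H. induction n as [|n IH]; simpl; [apply Clim_const|].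
now apply Clim_mult.
Qed.

(** Telescoping turns a product into a sum, which makes Tannery's theorem for sums applicable to
    products. *)
Lemma cprod_sum (f : nat -> C) (n : nat) :
  cprod f (S n) = 1 + sum_n (fun i => cprod f i * (f i - 1)) n.
Proof.
induction n as [|n IH].
- rewrite sum_O. simpl. ring.
- rewrite sum_Sn.
  change (plus (sum_n (fun i => cprod f i * (f i - 1)) n) (cprod f (S n) * (f (S n) - 1)))
    with (sum_n (fun i => cprod f i * (f i - 1)) n + cprod f (S n) * (f (S n) - 1)).
  change (cprod f (S (S n))) with (cprod f (S n) * f (S n)).
  replace (cprod f (S n) * f (S n))
    with (cprod f (S n) + cprod f (S n) * (f (S n) - 1)) by ring.
  rewrite IH at 1. ring.
Qed.

Lemma cprod_bound (f : nat -> C) (K r : R) (n : nat) :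
  (0 <= r < 1)%R -> (forall i, (i < n)%nat -> (Cmod (f i - 1) <= K * r ^ i)%R) ->
  (Cmod (cprod f n) <= exp (K * (1 - r ^ n) / (1 - r)))%R.
Proof.
intros Hr H. induction n as [|n IH].
- simpl. rewrite Cmod_1. replace (K * (1 - 1) / (1 - r))%R with 0%R by (field; lra).
  rewrite exp_0. lra.
- simpl cprod. rewrite Cmod_mult.
  replace (K * (1 - r ^ S n) / (1 - r))%R
    with (K * (1 - r ^ n) / (1 - r) + K * r ^ n)%R by (simpl; field; lra).
  rewrite exp_plus.
  apply Rmult_le_compat; try apply Cmod_ge_0.
  + apply IH. intros i Hi. apply H. lia.
  (* The new factor has modulus at most 1 + K r^n, hence at most exp (K r^n). *)
  + assert (Ht := Cmod_triangle (f n - 1) 1).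
    replace (f n - 1 + 1) with (f n) in Ht by ring. rewrite Cmod_1 in Ht.
    assert (He := exp_ineq1_le (K * r ^ n)).
    specialize (H n ltac:(lia)). lra.
Qed.

Lemma cprod_bound_exp (f : nat -> C) (K r : R) (n : nat) :
  (0 <= r < 1)%R -> (forall i, (i < n)%nat -> (Cmod (f i - 1) <= K * r ^ i)%R) ->
  (0 <= K)%R ->
  (Cmod (cprod f n) <= exp (K / (1 - r)))%R.
Proof.
intros Hr H HK. eapply Rle_trans; [now apply cprod_bound with (K := K) (r := r)|].
assert (Hle : (K * (1 - r ^ n) / (1 - r) <= K / (1 - r))%R).
{ unfold Rdiv. apply Rmult_le_compat_r; [apply Rlt_le, Rinv_0_lt_compat; lra|].
  assert (Hp := pow_le r n ltac:(lra)). nra. }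
destruct Hle as [Hlt|Heq]; [left; now apply exp_increasing|right; now rewrite Heq].
Qed.

Lemma tannery_prod (f : nat -> nat -> C) (g : nat -> C) (phi : nat -> nat)
    (K r : R) :
  (0 <= r < 1)%R -> (0 <= K)%R -> (forall N, (N <= phi N)%nat) ->
  (forall N i, (i <= phi N)%nat -> (Cmod (f N i - 1) <= K * r ^ i)%R) ->
  (forall i, Clim (fun N => f N i) (g i)) ->
  exists l : C, Clim (cprod g) l /\ Clim (fun N => cprod (f N) (S (phi N))) l.
Proof.
intros Hr HK Hphi Hf Hfg.
(* In the telescoped sum the partial product is at most exp (K / (1 - r)) and the remaining factor
   at most K r^i, whence the constant. *)
destruct (tannery_sum (fun N i => cprod (f N) i * (f N i - 1))
            (fun i => cprod g i * (g i - 1)) phi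
            (exp (K / (1 - r)) * K) r Hr Hphi) as [l [Hl1 Hl2]].
- intros N i Hi. rewrite Cmod_mult, Rmult_assoc.
  apply Rmult_le_compat; try apply Cmod_ge_0; [|now apply Hf].
  apply cprod_bound_exp; [exact Hr| |exact HK].
  intros j Hj. apply Hf. lia.
- intros i. apply Clim_mult; [now apply Clim_cprod|].
  apply Clim_plus; [apply Hfg|apply Clim_const].
- exists (1 + l). split.
  (* The telescoped form covers only nonempty products, so index 0 is discarded and [n] is shifted
     by [pred]. *)
  + apply Clim_eventually_ext with (N := 1%nat)
      (u := fun n => 1 + sum_n (fun i => cprod g i * (g i - 1)) (pred n)).
    * intros [|n] Hn; [lia|]. simpl pred. now rewrite cprod_sum.
    * apply Clim_plus; [apply Clim_const|].
      intros P HP. destruct (Hl1 P HP) as [N HN].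
      exists (S N). intros n Hn. apply HN. lia.
  + eapply Clim_ext; [|exact (Clim_plus _ _ _ _ (Clim_const 1) Hl2)].
    intros N. now rewrite cprod_sum.
Qed.

(** * q-series *)

Lemma one_minus_neq0 (z : C) : (Cmod z < 1)%R -> 1 - z <> 0.
Proof.
intros Hz H. assert (Hz1 : z = 1) by (rewrite <- (Cplus_0_r z), <- H; ring).
rewrite Hz1, Cmod_1 in Hz. lra.
Qed.

Lemma Cmod_pow_le1 (q : C) (n : nat) : (Cmod q < 1)%R -> (Cmod (q ^ n) <= 1)%R.
Proof.
intros Hq. rewrite Cmod_pow. rewrite <- (pow1 n). apply pow_incr.
split; [apply Cmod_ge_0|lra].
Qed.

Lemma Cmod_mul_pow_lt1 (a q : C) (n : nat) :
  (Cmod a < 1)%R -> (Cmod q < 1)%R -> (Cmod (a * q ^ n) < 1)%R.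
Proof.
intros Ha Hq. rewrite Cmod_mult.
assert (H1 := Cmod_pow_le1 q n Hq). assert (H2 := Cmod_ge_0 (q ^ n)).
assert (H3 := Cmod_ge_0 a). nra.
Qed.

Lemma Cmod_pow_lt1 (q : C) (n : nat) : (Cmod q < 1)%R -> (Cmod (q ^ S n) < 1)%R.
Proof. intros Hq. rewrite Cpow_S. now apply Cmod_mul_pow_lt1. Qed.

Lemma Cmod_opp_lt1 (z : C) : (Cmod z < 1)%R -> (Cmod (- z) < 1)%R.
Proof. now rewrite Cmod_opp. Qed.

Lemma one_plus_neq0 (z : C) : (Cmod z < 1)%R -> 1 + z <> 0.
Proof.
intros Hz. replace (1 + z) with (1 - - z) by ring.
now apply one_minus_neq0, Cmod_opp_lt1.
Qed.

Lemma qpoch_cprod (a q : C) (n : nat) :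
  qpoch a q n = cprod (fun i => 1 - a * q ^ i) n.
Proof. induction n as [|n IH]; simpl; [easy|now rewrite IH]. Qed.

Lemma qpoch_neq0 (a q : C) (n : nat) :
  (Cmod a < 1)%R -> (Cmod q < 1)%R -> qpoch a q n <> 0.
Proof.
intros Ha Hq. induction n as [|n IH]; simpl.
- intros H. apply RtoC_inj in H. lra.
- apply Cmult_neq_0; [exact IH|]. now apply one_minus_neq0, Cmod_mul_pow_lt1.
Qed.

Lemma qpoch_inv_cprod (a q : C) (n : nat) :
  (Cmod a < 1)%R -> (Cmod q < 1)%R ->
  / qpoch a q n = cprod (fun i => / (1 - a * q ^ i)) n.
Proof.
intros Ha Hq. induction n as [|n IH]; simpl; [field|].
assert (H := one_minus_neq0 _ (Cmod_mul_pow_lt1 a q n Ha Hq)).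
assert (H0 := qpoch_neq0 a q n Ha Hq).
rewrite <- IH. now field.
Qed.

Lemma qpoch_inf_ex (a q : C) :
  (Cmod q < 1)%R -> exists l, is_qpoch_inf a q l.
Proof.
intros Hq.
destruct (tannery_prod (fun _ i => 1 - a * q ^ i) (fun i => 1 - a * q ^ i)
            (fun N => N) (Cmod a) (Cmod q)) as [l [Hl _]].
- split; [apply Cmod_ge_0|exact Hq].
- apply Cmod_ge_0.
- intros N. lia.
- intros N i _. replace (1 - a * q ^ i - 1) with (- (a * q ^ i)) by ring.
  rewrite Cmod_opp, Cmod_mult, Cmod_pow. lra.
- intros i. apply Clim_const.
- exists l. apply Clim_ext with (2 := Hl). intros n. now rewrite qpoch_cprod.
Qed.

Lemma qpoch_inv_lim (a q : C) :
  (Cmod a < 1)%R -> (Cmod q < 1)%R ->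
  exists l, Clim (fun n => / qpoch a q n) l.
Proof.
intros Ha Hq.
(* The majorant comes from 1/(1 - a q^i) - 1 = a q^i / (1 - a q^i), where |a| < 1 and the
   denominator has modulus at least 1 - |a|. *)
destruct (tannery_prod (fun _ i => / (1 - a * q ^ i)) (fun i => / (1 - a * q ^ i))
            (fun N => N) (/ (1 - Cmod a)) (Cmod q)) as [l [Hl _]].
- split; [apply Cmod_ge_0|exact Hq].
- apply Rlt_le, Rinv_0_lt_compat. lra.
- intros N. lia.
- intros N i _.
  assert (H := one_minus_neq0 _ (Cmod_mul_pow_lt1 a q i Ha Hq)).
  replace (/ (1 - a * q ^ i) - 1) with (a * q ^ i * / (1 - a * q ^ i))
    by (field; repeat split; exact H).
  rewrite Cmod_mult, Cmod_inv, Cmod_mult, Cmod_pow, Rmult_comm by exact H.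
  assert (Hp := pow_le (Cmod q) i (Cmod_ge_0 q)).
  assert (Ha0 := Cmod_ge_0 a).
  assert (Hlow : (1 - Cmod a <= Cmod (1 - a * q ^ i))%R).
  { assert (Ht := Cmod_triangle (1 - a * q ^ i) (a * q ^ i)).
    replace (1 - a * q ^ i + a * q ^ i) with (RtoC 1) in Ht by ring.
    rewrite Cmod_1, Cmod_mult in Ht.
    assert (H1 := Cmod_pow_le1 q i Hq). nra. }
  apply Rmult_le_compat; [apply Rlt_le, Rinv_0_lt_compat; lra|nra| |nra].
  apply Rinv_le_contravar; lra.
- intros i. apply Clim_const.
- exists l. apply Clim_ext with (2 := Hl). intros n.
  now rewrite qpoch_inv_cprod.
Qed.

(** The reciprocal products converge as well, and the two limits multiply to 1; this rules out a
    vanishing infinite product. *)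
Lemma qpoch_inf_inv (a q l : C) :
  (Cmod a < 1)%R -> (Cmod q < 1)%R -> is_qpoch_inf a q l ->
  l <> 0 /\ Clim (fun n => / qpoch a q n) (/ l).
Proof.
intros Ha Hq Hl. destruct (qpoch_inv_lim a q Ha Hq) as [m Hm].
assert (E : l * m = 1).
{ apply (Clim_unique (fun n => qpoch a q n * / qpoch a q n)).
  - now apply Clim_mult.
  - apply Clim_ext with (2 := Clim_const 1). intros n.
    field. now apply qpoch_neq0. }
assert (Hl0 : l <> 0).
{ intros H. rewrite H, Cmult_0_l in E. apply RtoC_inj in E. lra. }
split; [exact Hl0|]. replace (/ l) with m; [exact Hm|].
rewrite <- (Cmult_1_r (/ l)), <- E. now field.
Qed.

Lemma qpoch_bounded (a q : C) :
  (Cmod q < 1)%R -> exists K, (0 < K)%R /\ forall n, (Cmod (qpoch a q n) <= K)%R.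
Proof.
intros Hq. destruct (qpoch_inf_ex a q Hq) as [l Hl].
exact (Clim_bounded _ l Hl).
Qed.

Lemma qpoch_inv_bounded (a q : C) :
  (Cmod a < 1)%R -> (Cmod q < 1)%R ->
  exists K, (0 < K)%R /\ forall n, (Cmod (/ qpoch a q n) <= K)%R.
Proof.
intros Ha Hq. destruct (qpoch_inv_lim a q Ha Hq) as [l Hl].
exact (Clim_bounded _ l Hl).
Qed.

(** The two lengths are independent because [moment_term] pairs [n] with [S n]. *)
Lemma qpoch_ratio_bounded (a b q : C) :
  (Cmod b < 1)%R -> (Cmod q < 1)%R ->
  exists K, (0 < K)%R /\
    forall n m, (Cmod (qpoch a q n / qpoch b q m) <= K)%R.
Proof.
intros Hb Hq. destruct (qpoch_bounded a q Hq) as [K [HK H]].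
destruct (qpoch_inv_bounded b q Hb Hq) as [K' [HK' H']].
exists (K * K')%R. split; [now apply Rmult_lt_0_compat|].
intros n m. unfold Cdiv. rewrite Cmod_mult.
apply Rmult_le_compat; auto using Cmod_ge_0.
Qed.

(** * Splitting of q-shifted factorials and the q-binomial theorem *)

Lemma qpoch_add (a q : C) (m n : nat) :
  qpoch a q (m + n) = qpoch a q m * qpoch (a * q ^ m) q n.
Proof.
induction n as [|n IH].
- rewrite Nat.add_0_r. simpl. ring.
- rewrite Nat.add_succ_r. simpl. rewrite IH, Cpow_add_r. ring.
Qed.

Lemma qpoch_succ_l (a q : C) (n : nat) :
  qpoch a q (S n) = (1 - a) * qpoch (a * q) q n.
Proof.
rewrite (qpoch_add a q 1 n : qpoch a q (S n) = _). rewrite Cpow_1_r.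
simpl. ring.
Qed.

Lemma qpoch_double (a q : C) (n : nat) :
  qpoch a q (2 * n) = qpoch a (q ^ 2) n * qpoch (a * q) (q ^ 2) n.
Proof.
induction n as [|n IH]; [simpl; ring|].
replace (2 * S n)%nat with (S (S (2 * n))) by lia.
change (qpoch a q (S (S (2 * n))))
  with (qpoch a q (2 * n) * (1 - a * q ^ (2 * n)) * (1 - a * q ^ S (2 * n))).
rewrite IH. cbn [qpoch]. rewrite <- (Cpow_mult_r q 2 n), (Cpow_S q (2 * n)). ring.
Qed.

Lemma qpoch_inf_add (a q l l' : C) (m : nat) :
  is_qpoch_inf a q l -> is_qpoch_inf (a * q ^ m) q l' ->
  l = qpoch a q m * l'.
Proof.
intros Hl Hl'. apply (Clim_unique (fun n => qpoch a q (m + n))).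
- apply (Clim_subseq (qpoch a q) l (fun n => (m + n)%nat)); [intros; lia|exact Hl].
- eapply Clim_ext; [|exact (Clim_mult _ _ _ _ (Clim_const (qpoch a q m)) Hl')].
  intros n. now rewrite qpoch_add.
Qed.

Lemma qpoch_inf_double (a q l l' : C) :
  (Cmod q < 1)%R -> is_qpoch_inf a (q ^ 2) l -> is_qpoch_inf (a * q) (q ^ 2) l' ->
  is_qpoch_inf a q (l * l').
Proof.
intros Hq Hl Hl'.
destruct (qpoch_inf_ex a q Hq) as [m Hm].
replace (l * l') with m; [exact Hm|].
apply (Clim_unique (fun n => qpoch a q (2 * n))).
- apply (Clim_subseq (qpoch a q) m (fun n => (2 * n)%nat)); [intros; lia|exact Hm].
- eapply Clim_ext; [|exact (Clim_mult _ _ _ _ Hl Hl')].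
  intros n. now rewrite qpoch_double.
Qed.

(** The q-binomial theorem. Let s_k be the series at z q^k. A first-order functional equation links
    s_k to s_(k+1); iterating it and letting k grow, with s_k tending to 1, gives D s_0 = N. *)
Lemma qbinomial (a q z N D : C) :
  (Cmod q < 1)%R -> (Cmod z < 1)%R ->
  is_qpoch_inf (a * z) q N -> is_qpoch_inf z q D ->
  is_series (fun n => qpoch a q n / qpoch q q n * z ^ n) (N / D).
Proof.
intros Hq Hz HN HD.
set (A := fun n => qpoch a q n / qpoch q q n).
destruct (qpoch_ratio_bounded a q q Hq Hq) as [K [HK HA]].
assert (Hq0 := Cmod_ge_0 q). assert (Hz0 := Cmod_ge_0 z).
assert (Hbound : forall k i, (Cmod (A i * (z * q ^ k) ^ i) <= K * Cmod z ^ i)%R).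
{ intros k i. rewrite Cmod_mult, Cpow_mult_l, Cmod_mult, (Cmod_pow z).
  assert (H1 := HA i i). assert (H2 := Cmod_ge_0 (A i)).
  assert (H3 := pow_le _ i Hz0).
  assert (H4 : (Cmod ((q ^ k) ^ i) <= 1)%R).
  { rewrite <- Cpow_mult_r. now apply Cmod_pow_le1. }
  assert (H5 := Cmod_ge_0 ((q ^ k) ^ i)). unfold A in *.
  apply Rmult_le_compat; [exact H2|nra|exact H1|nra]. }
assert (Hex : forall k, exists s : C, is_series (fun i => A i * (z * q ^ k) ^ i) s).
{ intros k. apply (ex_series_dominated _ K (Cmod z)); [lra|apply Hbound]. }
destruct (functional_choice _ Hex) as [s Hs].
(* The difference s_k - s_(k+1) is computed twice: directly, where the constant terms cancel, and
   through A_(i+1) (1 - q^(i+1)) = A_i (1 - a q^i). *)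
assert (Hfun : forall k, (1 - z * q ^ k) * s k = (1 - a * z * q ^ k) * s (S k)).
{ intros k. set (w := z * q ^ k).
  assert (H1 : is_series (fun i => A (S i) * w ^ S i - A (S i) * (w * q) ^ S i)
                 (s k - s (S k))).
  { eapply is_series_Ceq; [| |exact (proj1 (is_series_Cshift _ _)
      (is_series_Cplus _ _ _ _ (Hs k) (is_series_Cscal (-1) _ _ (Hs (S k)))))].
    - intros n. cbv beta. rewrite (Cpow_S q k). unfold w.
      replace (z * (q * q ^ k)) with (z * q ^ k * q) by ring. ring.
    - simpl. ring. }
  assert (H2 : is_series (fun i => A (S i) * w ^ S i - A (S i) * (w * q) ^ S i)
                 (w * s k - a * w * s (S k))).
  { eapply is_series_Ceq; [| |exact (is_series_Cplus _ _ _ _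
      (is_series_Cscal w _ _ (Hs k)) (is_series_Cscal (- (a * w)) _ _ (Hs (S k))))].
    - intros n. cbv beta. rewrite (Cpow_S q k).
      replace (z * (q * q ^ k)) with (w * q) by (unfold w; ring). fold w.
      rewrite !(Cpow_mult_l w q), !Cpow_S. unfold A. simpl qpoch.
      assert (H3 := qpoch_neq0 q q n Hq Hq).
      assert (H4 := one_minus_neq0 _ (Cmod_mul_pow_lt1 q q n Hq Hq)).
      field. now split.
    - ring. }
  assert (E := is_series_Cunique _ _ _ H1 H2).
  replace (a * z * q ^ k) with (a * w) by (unfold w; ring).
  transitivity (s k - s (S k) + s (S k) - w * s k); [ring|].
  rewrite E. ring. }
assert (Hiter : forall k, qpoch z q k * s O = qpoch (a * z) q k * s k).
{ induction k as [|k IH]; [simpl; ring|]. simpl.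
  transitivity ((qpoch z q k * s O) * (1 - z * q ^ k)); [ring|].
  rewrite IH. transitivity (qpoch (a * z) q k * ((1 - z * q ^ k) * s k)); [ring|].
  rewrite Hfun. ring. }
(* As k grows, z q^k tends to 0 and only the term i = 0 survives, so the limit series is the
   indicator of 0. *)
assert (Hlim : Clim s 1).
{ destruct (tannery (fun k i => A i * (z * q ^ k) ^ i)
    (fun i => if le_dec i 0 then RtoC 1 else RtoC 0) s K (Cmod z)) as [l [Hl1 Hl2]].
  - lra.
  - exact Hbound.
  - intros [|i]; simpl.
    + apply Clim_ext with (2 := Clim_const 1). intros n. unfold A. simpl. field.
    + apply Clim_ext with (u := fun k => (A (S i) * z ^ S i) * (q ^ S i) ^ k).
      * intros n. rewrite <- Cpow_mult_r.
        change (z * q ^ n * (z * q ^ n) ^ i) with ((z * q ^ n) ^ S i).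
        rewrite Cpow_mult_l, <- Cpow_mult_r, (Nat.mul_comm n). ring.
      * replace (RtoC 0) with (A (S i) * z ^ S i * 0) by ring.
        apply Clim_mult; [apply Clim_const|]. now apply Clim_pow0, Cmod_pow_lt1.
  - exact Hs.
  - replace (RtoC 1) with l; [exact Hl2|].
    apply (is_series_Cunique _ _ _ Hl1).
    eapply is_series_Ceq; [| |exact (is_series_truncate (fun _ => RtoC 1) 0)].
    + intros n. reflexivity.
    + apply sum_O. }
assert (E : D * s O = N).
{ apply (Clim_unique (fun k => qpoch z q k * s O)).
  - now apply Clim_mult; [|apply Clim_const].
  - replace N with (N * 1) by ring. eapply Clim_ext; [|exact (Clim_mult _ _ _ _ HN Hlim)].
    intros k. now rewrite Hiter. }
destruct (qpoch_inf_inv z q D Hz Hq HD) as [HD0 _].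
eapply is_series_Ceq; [| |exact (Hs O)].
- intros n. cbv beta. replace (z * q ^ 0) with z by (simpl; ring). reflexivity.
- rewrite <- E. now field.
Qed.

(** Splitting both infinite products at [k] confines the dependence on [k] to a finite ratio. For a
    = -1, z = -q and base q^2 that ratio is (-q;q^2)_k / (q;q^2)_k. *)
Lemma qbinomial_shift (a q z N D : C) (k : nat) :
  (Cmod q < 1)%R -> (Cmod z < 1)%R -> (Cmod (a * z) < 1)%R ->
  is_qpoch_inf (a * z) q N -> is_qpoch_inf z q D ->
  is_series (fun n => qpoch a q n / qpoch q q n * (z * q ^ k) ^ n)
    (N / D * (qpoch z q k / qpoch (a * z) q k)).
Proof.
intros Hq Hz Haz HN HD.
destruct (qpoch_inf_ex (a * z * q ^ k) q Hq) as [N' HN'].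
destruct (qpoch_inf_ex (z * q ^ k) q Hq) as [D' HD'].
assert (Hzk := Cmod_mul_pow_lt1 z q k Hz Hq).
rewrite (qpoch_inf_add _ _ _ _ _ HN HN'), (qpoch_inf_add _ _ _ _ _ HD HD').
eapply is_series_Ceq; [reflexivity| |apply (qbinomial a q (z * q ^ k) N' D')]; trivial.
- assert (HD0 := proj1 (qpoch_inf_inv _ _ _ Hzk Hq HD')).
  field. repeat split; trivial; now apply qpoch_neq0.
- now replace (a * (z * q ^ k)) with (a * z * q ^ k) by ring.
Qed.

Lemma is_series_telescope (g : nat -> C) :
  Clim g 0 -> is_series (fun n => g n - g (S n)) (g O).
Proof.
intros Hg. apply Clim_ext with (u := fun n => g O + -1 * g (S n)).
- intros n. induction n as [|n IH].
  + rewrite sum_O. ring.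
  + rewrite sum_Sn, <- IH.
    change (g O + -1 * g (S (S n)) = g O + -1 * g (S n) + (g (S n) - g (S (S n)))).
    ring.
- assert (H := Clim_plus _ _ _ _ (Clim_const (g O)) (Clim_mult _ _ _ _
    (Clim_const (-1)) (Clim_subseq g 0 S (fun n => Nat.le_succ_diag_r n) Hg))).
  replace (g O + -1 * 0) with (g O) in H by ring. exact H.
Qed.

(** * The first identity *)

(** The factor of index j < k vanishes only if q^(N-j) = 1, which |q| < 1 excludes since N - j is
    positive. *)
Lemma qpoch_inv_pow_neq0 (q : C) (N k : nat) :
  q <> 0 -> (Cmod q < 1)%R -> (k <= N)%nat -> qpoch (/ q ^ N) q k <> 0.
Proof.
intros Hq0 Hq Hk. induction k as [|k IH].
- intros H. apply RtoC_inj in H. lra.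
- simpl. apply Cmult_neq_0; [apply IH; lia|].
  assert (Hp := Cpow_nz q k Hq0). assert (Hp' := Cpow_nz q (N - k) Hq0).
  assert (E : q ^ N = q ^ k * q ^ (N - k)) by (rewrite <- Cpow_add_r; f_equal; lia).
  assert (H1 := one_minus_neq0 _ (Cmod_pow_lt1 q (N - k - 1) Hq)).
  replace (S (N - k - 1)) with (N - k)%nat in H1 by lia.
  rewrite E. intros H. apply H1.
  transitivity (- q ^ (N - k) * (1 - / (q ^ k * q ^ (N - k)) * q ^ k)).
  + field. now split.
  + rewrite H. ring.
Qed.

(** For a = q^(-N-1) the lower parameter aq equals the upper parameter q^(-N), and a b q^(N+1)
    reduces to b. The two equal factorials are nonzero in the range k <= N of the sum and cancel. *)
Lemma little_qJacobi_degenerate (q x b : C) (N : nat) :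
  q <> 0 -> (Cmod q < 1)%R ->
  little_qJacobi N x (/ q ^ S N) b q
  = sum_n (fun k => qpoch b q k / qpoch q q k * (q * x) ^ k) N.
Proof.
intros Hq0 Hq. unfold little_qJacobi.
apply (@sum_n_ext_loc C_AbelianMonoid). intros k Hk.
assert (Hp := Cpow_nz q N Hq0).
replace (/ q ^ S N * b * q ^ S N) with b
  by (rewrite Cpow_S; field; now split).
replace (/ q ^ S N * q) with (/ q ^ N) by (rewrite Cpow_S; field; now split).
assert (H1 := qpoch_inv_pow_neq0 q N k Hq0 Hq Hk).
assert (H2 := qpoch_neq0 q q k Hq Hq).
(* The equality left by [sum_n_ext_loc] lives in the carrier of [C_AbelianMonoid]; [field] needs it
   in [C]. *)
match goal with |- ?l = ?r => change (@eq C l r) end.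
field. now split.
Qed.

(** * The moments B_N and their closed form *)

Lemma Clim0_dominated (u v : nat -> C) (K : R) :
  (0 < K)%R -> (forall n, (Cmod (u n) <= K * Cmod (v n))%R) ->
  Clim v 0 -> Clim u 0.
Proof.
intros HK H Hv. apply Clim_eps. intros eps He.
destruct (proj1 (Clim_eps _ _) Hv (eps / K)%R (Rdiv_lt_0_compat _ _ He HK))
  as [N HN].
exists N. intros n Hn. specialize (HN n Hn).
replace (v n - 0) with (v n) in HN by ring.
replace (u n - 0) with (u n) by ring.
eapply Rle_lt_trans; [apply H|].
apply Rmult_lt_reg_l with (/ K)%R; [now apply Rinv_0_lt_compat|].
rewrite <- Rmult_assoc, Rinv_l, Rmult_1_l by lra.
rewrite Rmult_comm. exact HN.
Qed.

(* The terms are indexed from 0: [n] here is the summation index minus one. *)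
Definition moment_term (q : C) (N n : nat) : C :=
  qpoch q q n / qpoch (- q) q (S n) * q ^ (S n * S N).

Lemma moment_term_bound (q : C) :
  (Cmod q < 1)%R ->
  exists K, (0 < K)%R /\ forall N n,
    (Cmod (moment_term q N n) <= K * Cmod q ^ N * Cmod q ^ n)%R.
Proof.
intros Hq.
destruct (qpoch_ratio_bounded q (- q) q (Cmod_opp_lt1 q Hq) Hq) as [K [HK H]].
exists K. split; [exact HK|]. intros N n. unfold moment_term.
rewrite Cmod_mult, Rmult_assoc.
apply Rmult_le_compat; try apply Cmod_ge_0; [apply H|].
(* The exponent is split so that q^N and q^n give the majorant, while the remaining power has
   modulus at most 1. *)
replace (S n * S N)%nat with (N + n + S (n * N))%nat by lia.
rewrite Cpow_add_r, Cmod_mult, Cmod_pow, pow_add.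
assert (H1 := Cmod_pow_le1 q (S (n * N)) Hq).
assert (H2 := Cmod_ge_0 (q ^ S (n * N))).
assert (H3 : (0 <= Cmod q ^ N * Cmod q ^ n)%R).
{ apply Rmult_le_pos; apply pow_le, Cmod_ge_0. }
nra.
Qed.

(** With M = N + 1, put g_n = q^M (q;q)_n / (-q;q)_n q^(nM). In g_n - g_(n+1) the bracket 1 +
    q^(n+1) - q^M (1 - q^(n+1)) regroups as (1 - q^M) + q^(n+1) (1 + q^M), which are the two
    coefficients; the telescoped sum is g_0 = q^M. *)
Lemma moment_rec (q b b' : C) (N : nat) :
  (Cmod q < 1)%R ->
  is_series (moment_term q N) b -> is_series (moment_term q (S N)) b' ->
  (1 + q ^ S N) * b' + (1 - q ^ S N) * b = q ^ S N.
Proof.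
intros Hq Hb Hb'. set (M := S N).
assert (Hmq := Cmod_opp_lt1 q Hq).
destruct (qpoch_ratio_bounded q (- q) q Hmq Hq) as [K [HK HA]].
assert (Hg : Clim (fun n => q ^ M * (qpoch q q n / qpoch (- q) q n * q ^ (n * M))) 0).
{ apply (Clim0_dominated _ (fun n => q ^ n) K HK); [|now apply Clim_pow0].
  intros n. unfold M. rewrite !Cmod_mult.
  replace (n * S N)%nat with (n + n * N)%nat by lia.
  rewrite Cpow_add_r, Cmod_mult.
  assert (H1 := Cmod_pow_le1 q (S N) Hq). assert (H2 := Cmod_pow_le1 q (n * N) Hq).
  assert (H3 := HA n n).
  assert (H4 := Cmod_ge_0 (q ^ S N)). assert (H5 := Cmod_ge_0 (q ^ (n * N))).
  assert (H6 := Cmod_ge_0 (qpoch q q n / qpoch (- q) q n)).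
  assert (H7 := Cmod_ge_0 (q ^ n)).
  rewrite <- (Rmult_1_l (K * _)).
  apply Rmult_le_compat; try apply Cmod_ge_0; trivial.
  - apply Rmult_le_pos; [trivial|now apply Rmult_le_pos].
  - apply Rmult_le_compat; trivial.
    + now apply Rmult_le_pos.
    + rewrite <- (Rmult_1_r (Cmod (q ^ n))) at 2.
      apply Rmult_le_compat; trivial. lra. }
apply (is_series_Cunique (fun n =>
  (1 + q ^ M) * moment_term q M n + (1 - q ^ M) * moment_term q N n)).
- apply is_series_Cplus; now apply is_series_Cscal.
- eapply is_series_Ceq; [| |exact (is_series_telescope _ Hg)].
  + intros n. unfold moment_term. cbv beta.
    change (S n * M)%nat with (M + n * M)%nat.
    replace (S n * S M)%nat with (M + n * M + S n)%nat by (unfold M; lia).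
    change (S n * S N)%nat with (M + n * M)%nat.
    rewrite !Cpow_add_r, !Cpow_S. cbn [qpoch].
    assert (H1 := qpoch_neq0 (- q) q n Hmq Hq).
    assert (H2 := one_minus_neq0 _ (Cmod_mul_pow_lt1 (- q) q n Hmq Hq)).
    field. now split.
  + simpl. field.
Qed.

Lemma moment_closed_form (q P M : C) (b : nat -> C) :
  (Cmod q < 1)%R -> is_qpoch_inf q q P -> is_qpoch_inf (- q) q M ->
  (forall N, is_series (moment_term q N) (b N)) ->
  forall N, 2 * (-1) ^ N * qpoch (- q) q N / qpoch q q N * b N
    = sum_n (fun k => qpoch (-1) q k / qpoch q q k * (- q) ^ k) N - P / M.
Proof.
intros Hq HP HM Hb.
assert (Hmq := Cmod_opp_lt1 q Hq).
set (u := fun k => qpoch (-1) q k / qpoch q q k * (- q) ^ k).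
set (d := fun N => 2 * (-1) ^ N * qpoch (- q) q N / qpoch q q N * b N).
assert (Hu : is_series u (P / M)).
{ apply qbinomial; trivial. now replace (-1 * - q) with q by ring. }
(* By the moment recurrence, [d] has the increments of the partial sums of [u], so the two differ by
   a constant. *)
assert (Hstep : forall N, d (S N) - sum_n u (S N) = d N - sum_n u N).
{ intros N. rewrite sum_Sn.
  change (plus (sum_n u N) (u (S N))) with (sum_n u N + u (S N)).
  assert (Hr := moment_rec q _ _ N Hq (Hb N) (Hb (S N))).
  assert (E : d (S N) - d N = u (S N)).
  { unfold d, u. rewrite (qpoch_succ_l (-1)).
    replace (-1 * q) with (- q) by ring.
    replace (- q) with (-1 * q) at 4 by ring.
    rewrite (Cpow_mult_l (-1) q), (Cpow_S (-1)), <- Hr. cbn [qpoch].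
    replace (1 - - q * q ^ N) with (1 + q ^ S N) by (rewrite Cpow_S; ring).
    replace (1 - q * q ^ N) with (1 - q ^ S N) by (rewrite Cpow_S; ring).
    assert (H1 := qpoch_neq0 q q N Hq Hq).
    assert (H2 := one_minus_neq0 _ (Cmod_pow_lt1 q N Hq)).
    field. now split. }
  rewrite <- E. ring. }
assert (Hconst : forall N, d N - sum_n u N = d O - sum_n u O).
{ induction N as [|N IH]; [easy|]. now rewrite Hstep. }
(* B_N is of order |q|^N and its prefactor is bounded, so [d] tends to 0; this identifies the
   constant as minus the full sum P / M. *)
assert (Hd0 : Clim d 0).
{ destruct (moment_term_bound q Hq) as [K [HK HB]].
  destruct (qpoch_ratio_bounded (- q) q q Hq Hq) as [K' [HK' HA]].
  assert (Hq0 := Cmod_ge_0 q).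
  set (K2 := (2 * (K' * (K / (1 - Cmod q))))%R).
  assert (HK2 : (0 < K2)%R).
  { unfold K2. apply Rmult_lt_0_compat; [lra|]. apply Rmult_lt_0_compat; [lra|].
    apply Rdiv_lt_0_compat; lra. }
  assert (Hdb : forall N, (Cmod (d N) <= K2 * Cmod (q ^ N))%R).
  { intros N. unfold d.
    replace (2 * (-1) ^ N * qpoch (- q) q N / qpoch q q N * b N)
      with (2 * ((-1) ^ N * (qpoch (- q) q N / qpoch q q N * b N)))
      by (unfold Cdiv; ring).
    rewrite !Cmod_mult, Cmod_pow, !Cmod_R.
    rewrite (Rabs_left (-1)), (Rabs_pos_eq 2) by lra.
    rewrite <- (opp_IZR (-1)), pow1, Rmult_1_l. unfold K2. rewrite !Rmult_assoc.
    apply Rmult_le_compat_l; [lra|].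
    apply Rmult_le_compat; try apply Cmod_ge_0; [apply HA|].
    assert (H1 : (Cmod (b N) <= K * Cmod q ^ N / (1 - Cmod q))%R).
    { apply (Clim_bound (sum_n (moment_term q N))); [|apply Hb].
      intros n. apply Cmod_sum_n_geom; [lra|apply HB]. }
    rewrite Cmod_pow. eapply Rle_trans; [exact H1|]. apply Req_le. field. lra. }
  apply (Clim0_dominated _ (fun n => q ^ n) K2 HK2 Hdb). now apply Clim_pow0. }
assert (E : d O - sum_n u O = - (P / M)).
{ apply (Clim_unique (fun N => d N + -1 * sum_n u N)).
  - apply Clim_ext with (2 := Clim_const (d O - sum_n u O)).
    intros N. rewrite <- (Hconst N). ring.
  - replace (- (P / M)) with (0 + -1 * (P / M)) by ring.
    apply Clim_plus; [exact Hd0|]. apply Clim_mult; [apply Clim_const|exact Hu]. }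
intros N. change (d N = sum_n u N - P / M).
transitivity (d N - sum_n u N + sum_n u N); [ring|].
rewrite Hconst, E. ring.
Qed.

(** * Two exchanges of summation and the resulting identity *)

Lemma qpoch_m1_shift (q : C) (n : nat) :
  qpoch (-1) q n * (1 + q ^ n) = 2 * qpoch (- q) q n.
Proof.
transitivity (qpoch (-1) q (S n)); [simpl; ring|].
rewrite qpoch_succ_l. replace (-1 * q) with (- q) by ring.
replace (1 - -1) with (RtoC 2) by (rewrite <- RtoC_minus; f_equal; lra).
reflexivity.
Qed.

(** Dividing c_m by the prefactor of B_(2m) gives the weight of the Jacobi series: the factors
    (q^2;q^2)_m cancel, and (-1;q^2)_m (1 + q^(2m)) = 2 (-q^2;q^2)_m. *)
Lemma qpoch_m1_double (q : C) (m : nat) :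
  (Cmod q < 1)%R -> 1 + q ^ (2 * m) <> 0 ->
  qpoch (-1) (q ^ 2) m / qpoch (q ^ 2) (q ^ 2) m
    * (qpoch q q (2 * m) / (2 * qpoch (- q) q (2 * m)))
  = qpoch q (q ^ 2) m / (qpoch (- q) (q ^ 2) m * (1 + q ^ (2 * m))).
Proof.
intros Hq H1. rewrite !qpoch_double.
replace (q * q) with (q ^ 2) by ring. replace (- q * q) with (- q ^ 2) by ring.
assert (Hq2 := Cmod_pow_lt1 q 1 Hq). assert (Hmq := Cmod_opp_lt1 q Hq).
assert (E := qpoch_m1_shift (q ^ 2) m). rewrite <- Cpow_mult_r in E.
assert (Ha := qpoch_neq0 (q ^ 2) (q ^ 2) m Hq2 Hq2).
assert (Hb := qpoch_neq0 (- q) (q ^ 2) m Hmq Hq2).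
assert (Hc := qpoch_neq0 (- q ^ 2) (q ^ 2) m (Cmod_opp_lt1 _ Hq2) Hq2).
set (X := qpoch (-1) (q ^ 2) m) in *.
replace X with (2 * qpoch (- q ^ 2) (q ^ 2) m / (1 + q ^ (2 * m)))
  by (rewrite <- E; field; exact H1).
field. repeat split; trivial.
Qed.

Lemma one_plus_pow_neq0 (q : C) (n : nat) : (Cmod q < 1)%R -> 1 + q ^ n <> 0.
Proof.
intros Hq. destruct n as [|n].
- simpl. intros H. rewrite <- RtoC_plus in H. apply RtoC_inj in H. lra.
- now apply one_plus_neq0, Cmod_pow_lt1.
Qed.

(** [F] is the series shared by both identities: it is q/(1-q) times the first left-hand side, and a
    constant multiple of it is the overpartition generating function. *)
Lemma double_series_identity (q P M Po Mo : C) :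
  q <> 0 -> (Cmod q < 1)%R ->
  is_qpoch_inf q q P -> is_qpoch_inf (- q) q M ->
  is_qpoch_inf q (q ^ 2) Po -> is_qpoch_inf (- q) (q ^ 2) Mo ->
  exists F S2 S3 : C,
    is_series (fun n => q ^ S n * qpoch (- q) (q ^ 2) (S n) * qpoch q q n
                        / (qpoch q (q ^ 2) (S n) * qpoch (- q) q (S n))) F /\
    is_series (fun n => qpoch (-1) q n * qpoch (- q) (q ^ 2) n
                        / (qpoch q (q ^ 2) n * qpoch q q n) * q ^ n) S2 /\
    is_series (fun n => qpoch q (q ^ 2) n * (- q) ^ n
                        / (qpoch (- q) (q ^ 2) n * (1 + q ^ (2 * n)))
                        * little_qJacobi (2 * n) (-1) (/ q ^ (2 * n + 1)) (-1) q) S3 /\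
    F = - / 2 * (P ^ 2 / M ^ 2) * S2 + Mo / Po * S3.
Proof.
intros Hq0 Hq HP HM HPo HMo.
assert (Hmq := Cmod_opp_lt1 q Hq). assert (Hq2 := Cmod_pow_lt1 q 1 Hq).
assert (Hr : (0 <= Cmod q < 1)%R) by (split; [apply Cmod_ge_0|exact Hq]).
assert (HP0 := proj1 (qpoch_inf_inv _ _ _ Hq Hq HP)).
assert (HM0 := proj1 (qpoch_inf_inv _ _ _ Hmq Hq HM)).
assert (HPo0 := proj1 (qpoch_inf_inv _ _ _ Hq Hq2 HPo)).
assert (HMo0 := proj1 (qpoch_inf_inv _ _ _ Hmq Hq2 HMo)).
assert (Em1 : -1 * - q = q) by ring.
assert (Em2 : -1 * q = - q) by ring.
set (c := fun m => qpoch (-1) (q ^ 2) m / qpoch (q ^ 2) (q ^ 2) m).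
assert (Hc : forall k, is_series (fun m => c m * (- q * (q ^ 2) ^ k) ^ m)
   (Po / Mo * (qpoch (- q) (q ^ 2) k / qpoch q (q ^ 2) k))).
{ intros k. assert (H := qbinomial_shift (-1) (q ^ 2) (- q) Po Mo k Hq2 Hmq).
  rewrite Em1 in H. exact (H Hq HPo HMo). }
destruct (qpoch_ratio_bounded (-1) (q ^ 2) (q ^ 2) Hq2 Hq2) as [K1 [HK1 Hc1]].
destruct (moment_term_bound q Hq) as [K2 [HK2 HB]].
destruct (qpoch_ratio_bounded (-1) q q Hq Hq) as [K3 [HK3 HA]].
assert (Hpow : forall m, (Cmod ((- q) ^ m) = Cmod q ^ m)%R).
{ intros m. now rewrite Cmod_pow, Cmod_opp. }
assert (Hbex : forall N, exists b : C, is_series (moment_term q N) b).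
{ intros N. apply (ex_series_dominated _ (K2 * Cmod q ^ N) (Cmod q) Hr (HB N)). }
destruct (functional_choice _ Hbex) as [b Hb].
assert (Hclosed := moment_closed_form q P M b Hq HP HM Hb).
(* Summation over m first gives Po/Mo times the terms of [F]; summation over n first gives moments
   of even order. *)
destruct (series_fubini (fun n m => c m * (- q) ^ m * moment_term q (2 * m) n)
   (fun m => c m * (- q) ^ m * b (2 * m)%nat)
   (fun n => Po / Mo * (q ^ S n * qpoch (- q) (q ^ 2) (S n) * qpoch q q n
                        / (qpoch q (q ^ 2) (S n) * qpoch (- q) q (S n))))
   (K1 * K2) (Cmod q) Hr) as [l1 [HF1 HF2]].
{ intros n m. rewrite !Cmod_mult, Hpow.
  assert (H1 := HB (2 * m)%nat n).
  assert (H2 : (K2 * Cmod q ^ (2 * m) * Cmod q ^ n <= K2 * Cmod q ^ n)%R).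
  { apply Rmult_le_compat_r; [now apply pow_le|].
    assert (Hp := Cmod_pow_le1 q (2 * m) Hq). rewrite Cmod_pow in Hp. nra. }
  replace (K1 * K2 * Cmod q ^ n * Cmod q ^ m)%R
    with (K1 * Cmod q ^ m * (K2 * Cmod q ^ n))%R by ring.
  apply Rmult_le_compat; [|apply Cmod_ge_0| |lra].
  - apply Rmult_le_pos; [apply Cmod_ge_0|now apply pow_le].
  - apply Rmult_le_compat_r; [now apply pow_le|apply Hc1]. }
{ intros n. eapply is_series_Ceq; [| |exact (is_series_Cscal
    (q ^ S n * qpoch q q n / qpoch (- q) q (S n)) _ _ (Hc (S n)))].
  - intros m. cbv beta. unfold moment_term.
    replace (S n * S (2 * m))%nat with (S n + 2 * (S n * m))%nat by lia.
    rewrite Cpow_add_r, Cpow_mult_l, <- !Cpow_mult_r.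
    unfold Cdiv. ring.
  - assert (H1 := qpoch_neq0 q (q ^ 2) (S n) Hq Hq2).
    assert (H2 := qpoch_neq0 (- q) q (S n) Hmq Hq).
    field. now repeat split. }
{ intros m. now apply is_series_Cscal. }
set (T := fun m => qpoch q (q ^ 2) m * (- q) ^ m
                   / (qpoch (- q) (q ^ 2) m * (1 + q ^ (2 * m)))).
assert (HT : forall m, T m =
   c m * (- q) ^ m * (qpoch q q (2 * m) / (2 * qpoch (- q) q (2 * m)))).
{ intros m. unfold T, c. assert (H1 := one_plus_pow_neq0 q (2 * m) Hq).
  transitivity ((- q) ^ m * (qpoch (-1) (q ^ 2) m / qpoch (q ^ 2) (q ^ 2) m
    * (qpoch q q (2 * m) / (2 * qpoch (- q) q (2 * m))))); [|ring].
  rewrite qpoch_m1_double by trivial. unfold Cdiv. ring. }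
(* Summation over m first gives Po/Mo times the terms of [S2]; summation over n first is the
   q-binomial theorem at q^(2m+1), which yields the Jacobi weights [T]. *)
destruct (series_fubini
   (fun n m => c m * (- q) ^ m * (qpoch (-1) q n / qpoch q q n * (q * q ^ (2 * m)) ^ n))
   (fun m => 2 * (M / P) * T m)
   (fun n => Po / Mo * (qpoch (-1) q n * qpoch (- q) (q ^ 2) n
                        / (qpoch q (q ^ 2) n * qpoch q q n) * q ^ n))
   (K1 * K3) (Cmod q) Hr) as [l2 [HG1 HG2]].
{ intros n m. rewrite !Cmod_mult, Hpow.
  assert (H1 := HA n n).
  assert (H2 : (Cmod ((q * q ^ (2 * m)) ^ n) <= Cmod q ^ n)%R).
  { rewrite Cmod_pow. apply pow_incr. split; [apply Cmod_ge_0|].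
    rewrite Cmod_mult. assert (Hp := Cmod_pow_le1 q (2 * m) Hq). nra. }
  replace (K1 * K3 * Cmod q ^ n * Cmod q ^ m)%R
    with (K1 * Cmod q ^ m * (K3 * Cmod q ^ n))%R by ring.
  apply Rmult_le_compat.
  - apply Rmult_le_pos; [apply Cmod_ge_0|now apply pow_le].
  - apply Rmult_le_pos; apply Cmod_ge_0.
  - apply Rmult_le_compat_r; [now apply pow_le|apply Hc1].
  - apply Rmult_le_compat; trivial; apply Cmod_ge_0. }
{ intros n. eapply is_series_Ceq; [| |exact (is_series_Cscal
    (qpoch (-1) q n / qpoch q q n * q ^ n) _ _ (Hc n))].
  - intros m. cbv beta.
    rewrite !Cpow_mult_l, <- !Cpow_mult_r.
    replace (2 * m * n)%nat with (2 * (n * m))%nat by lia. ring.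
  - assert (H1 := qpoch_neq0 q (q ^ 2) n Hq Hq2).
    assert (H2 := qpoch_neq0 q q n Hq Hq).
    field. now repeat split. }
{ intros m. assert (H := qbinomial_shift (-1) q q M P (2 * m) Hq Hq).
  rewrite Em2 in H.
  eapply is_series_Ceq; [| |exact (is_series_Cscal (c m * (- q) ^ m) _ _
    (H Hmq HM HP))]; [reflexivity|].
  rewrite HT.
  assert (H2 := qpoch_neq0 (- q) q (2 * m) Hmq Hq).
  field. now repeat split. }
set (F := Mo / Po * l1). set (S2 := Mo / Po * l2).
(* By the closed form, the Jacobi term is the even moment term plus P/M times [T]. The former sums
   to [l1]; [T] sums to P/(2M) times [l2]. *)
exists F, S2, (l1 + P / M * (P / (2 * M) * l2)).
split; [|split; [|split]].
- eapply is_series_Ceq; [|reflexivity|exact (is_series_Cscal (Mo / Po) _ _ HF1)].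
  intros n. cbv beta.
  transitivity (Mo / Po * (Po / Mo) * (q ^ S n * qpoch (- q) (q ^ 2) (S n) * qpoch q q n
     / (qpoch q (q ^ 2) (S n) * qpoch (- q) q (S n)))); [ring|].
  replace (Mo / Po * (Po / Mo)) with (RtoC 1) by (field; now split). ring.
- eapply is_series_Ceq; [|reflexivity|exact (is_series_Cscal (Mo / Po) _ _ HG1)].
  intros n. cbv beta.
  transitivity (Mo / Po * (Po / Mo) * (qpoch (-1) q n * qpoch (- q) (q ^ 2) n
                        / (qpoch q (q ^ 2) n * qpoch q q n) * q ^ n)); [ring|].
  replace (Mo / Po * (Po / Mo)) with (RtoC 1) by (field; now split). ring.
- eapply is_series_Ceq; [|reflexivity|exact (is_series_Cplus _ _ _ _ HF2
    (is_series_Cscal (P / M) _ _ (is_series_Cscal (P / (2 * M)) _ _ HG2)))].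
  intros m. cbv beta. fold (T m).
  rewrite Nat.add_1_r, little_qJacobi_degenerate by trivial.
  replace (q * -1) with (- q) by ring.
  assert (E := Hclosed (2 * m)%nat).
  replace ((-1) ^ (2 * m)) with (RtoC 1) in E.
  2:{ rewrite Cpow_mult_r. replace ((-1) ^ 2) with (RtoC 1) by ring.
      symmetry. apply Cpow_1_l. }
  set (J := sum_n _ _) in *.
  replace J with (2 * 1 * qpoch (- q) q (2 * m) / qpoch q q (2 * m) * b (2 * m)%nat + P / M)
    by (rewrite E; ring).
  rewrite HT.
  assert (H1 := qpoch_neq0 q q (2 * m) Hq Hq).
  assert (H2 := qpoch_neq0 (- q) q (2 * m) Hmq Hq).
  field. now repeat split.
- unfold F, S2. field. now repeat split.
Qed.

(** * Overpartitions *)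

Module OverpartitionCount.
Import all_boot zify.
Set Implicit Arguments.
Unset Strict Implicit.
Local Open Scope nat_scope.

(** These instances give big operators over [Cplus] and [Cmult] reindexing, exchange and the
    expansion of a product of sums. *)
HB.instance Definition _ :=
  Monoid.isComLaw.Build C (RtoC 0) Cplus Cplus_assoc Cplus_comm Cplus_0_l.
HB.instance Definition _ :=
  Monoid.isComLaw.Build C (RtoC 1) Cmult Cmult_assoc Cmult_comm Cmult_1_l.
HB.instance Definition _ :=
  Monoid.isMulLaw.Build C (RtoC 0) Cmult Cmult_0_l Cmult_0_r.
HB.instance Definition _ :=
  Monoid.isAddLaw.Build C Cmult Cplus
    (fun x y z => Cmult_plus_distr_r x y z) (fun x y z => Cmult_plus_distr_l x y z).

(** Once the smallest part [s] is fixed, the conditions on an overpartition separate into one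
    condition per part; this is what makes the generating function a product. *)
Definition allowed (s i k : nat) (b : bool) : bool :=
  if i < s then (k == 0) && ~~ b
  else if i == s then (0 < k) && b
  else (b ==> (0 < k)) && ((0 < k) && odd i ==> (i < 2 * s)).

Arguments allowed : simpl never.

(* The value at [i] is the multiplicity of the part [i] together with whether its
   first occurrence is overlined. *)
Definition config (N : nat) := {ffun 'I_N.+1 -> 'I_N.+1 * bool}.

Definition has_smallest N (f : config N) (s : 'I_N.+1) : bool :=
  (0 < s) && [forall i : 'I_N.+1, allowed s i (f i).1 (f i).2].

Definition weight N (f : config N) : nat := \sum_(i < N.+1) i * (f i).1.

Definition configs (N n : nat) : {set config N} :=
  [set f | [exists s, has_smallest f s] && (weight f == n)].

(** The smaller of two candidates must occur by its own condition and must be absent by that of the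
    other. Hence a sum over [s] counts each configuration once. *)
Lemma has_smallest_inj N (f : config N) (s t : 'I_N.+1) :
  has_smallest f s -> has_smallest f t -> s = t.
Proof.
have sub (u v : 'I_N.+1) : has_smallest f u -> has_smallest f v -> v <= u.
  move=> /andP[_ /forallP Hu] /andP[_ /forallP Hv]; rewrite leqNgt; apply/negP => Huv.
  have := Hu u; have := Hv u; rewrite /allowed Huv ltnn eqxx.
  by move=> /andP[/eqP-> _] /andP[].
by move=> Hs Ht; apply/val_inj/eqP; rewrite eqn_leq !sub.
Qed.

Lemma big_sum_n (F : nat -> C) n :
  \big[Cplus/RtoC 0]_(i < n.+1) F i = sum_n F n.
Proof.
elim: n => [|n IH]; first by rewrite big_ord_recr big_ord0 sum_O /= Cplus_0_l.
by rewrite big_ord_recr /= IH sum_Sn.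
Qed.

Lemma big_cprod (F : nat -> C) n : \big[Cmult/RtoC 1]_(i < n) F i = cprod F n.
Proof.
elim: n => [|n IH]; first by rewrite big_ord0.
by rewrite big_ord_recr /= IH.
Qed.

Lemma big_Cconst (I : finType) (P : pred I) (c : C) :
  \big[Cplus/RtoC 0]_(i | P i) c = Cmult (RtoC (INR #|P|)) c.
Proof.
rewrite big_const; elim: #|P| => [|n IH]; first by rewrite Cmult_0_l.
by rewrite iterS IH S_INR RtoC_plus; ring.
Qed.

Definition overlinings (s i k : nat) : nat := allowed s i k true + allowed s i k false.

Lemma big_allowed N (q : C) (s i : nat) :
  \big[Cplus/RtoC 0]_(p : 'I_N.+1 * bool | allowed s i p.1 p.2) Cpow q (i * p.1)
  = sum_n (fun k => Cmult (RtoC (INR (overlinings s i k))) (Cpow q (i * k))) N.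
Proof.
rewrite -big_sum_n.
rewrite -(pair_big_dep xpredT (fun k b => allowed s i (nat_of_ord k) b)
            (fun (k : 'I_N.+1) (b : bool) => Cpow q (i * k))) /=.
apply: eq_bigr => k _; rewrite big_Cconst; congr (Cmult (RtoC (INR _)) _).
by rewrite -sum1_card big_mkcond big_bool.
Qed.

(** Each of the N + 1 indices contributes at most N * N; this fixes the degree of the box
    polynomial. *)
Lemma weight_bound N (f : config N) : weight f < (N * (N * N.+1)).+1.
Proof.
rewrite ltnS /weight.
apply: (@leq_trans (\sum_(i < N.+1) N * N)).
  by apply: leq_sum => i _; apply: leq_mul; rewrite -ltnS.
by rewrite sum_nat_const card_ord; lia.
Qed.

Lemma box_generating_function (q : C) N :
  sum_n (fun s => if s is 0 then RtoC 0 else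
           cprod (fun i => sum_n (fun k =>
             Cmult (RtoC (INR (overlinings s i k))) (Cpow q (i * k))) N) N.+1) N
  = sum_n (fun n => Cmult (RtoC (INR #|configs N n|)) (Cpow q n)) (N * (N * N.+1)).
Proof.
rewrite -!big_sum_n.
transitivity (\big[Cplus/RtoC 0]_(s < N.+1)
    \big[Cplus/RtoC 0]_(f : config N | has_smallest f s) Cpow q (weight f)).
  apply: eq_bigr => s _.
  case Es : (nat_of_ord s) => [|s'].
    by rewrite big_pred0 // => f; rewrite /has_smallest Es.
  rewrite -Es -big_cprod.
  under eq_bigr => i _ do rewrite -big_allowed.
  (* Choosing one admissible pair for every part is choosing a configuration, so the product of sums
     expands into a sum over configurations. *)
  rewrite (bigA_distr_big_dep (fun (i : 'I_N.+1) p => allowed s i (nat_of_ord p.1) p.2)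
             (fun (i : 'I_N.+1) (p : 'I_N.+1 * bool) => Cpow q (i * p.1))).
  apply: eq_big => [f|f _].
    rewrite /has_smallest Es /=; apply/familyP/forallP => H i; exact: H.
  rewrite /weight; elim/big_rec2: _ => [//|i x y _ ->].
  by rewrite Cpow_add_r.
rewrite (exchange_big_dep xpredT) //=.
transitivity (\big[Cplus/RtoC 0]_(f : config N | [exists s, has_smallest f s])
    Cpow q (weight f)).
  rewrite [RHS]big_mkcond; apply: eq_bigr => f _.
  case: existsP => [[s Hs]|Hn].
    rewrite (big_pred1 s) // => t /=.
    by apply/idP/eqP => [Ht|->//]; apply: has_smallest_inj Ht Hs.
  by rewrite big_pred0 // => t; apply/negP => Ht; apply: Hn; exists t.
(* Configurations are grouped by weight; [weight_bound] makes [inord] faithful here. *)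
rewrite (partition_big (fun f => inord (weight f) : 'I_(N * (N * N.+1)).+1) xpredT) //=.
apply: eq_bigr => n _.
transitivity (\big[Cplus/RtoC 0]_(f in configs N n) Cpow q n).
  apply: eq_big => [f|f /andP[_ /eqP <-]].
    rewrite inE; congr andb; apply/eqP/eqP => [<-|E].
      by rewrite inordK // weight_bound.
    by apply/val_inj; rewrite /= inordK ?weight_bound.
  by rewrite inordK // weight_bound.
by rewrite big_Cconst.
Qed.

(** * Comparison of boxes of different sizes *)

Definition extend N (f : config N) (i : nat) : nat * bool :=
  if i <= N then (nat_of_ord (f (inord i)).1, (f (inord i)).2) else (0, false).

Lemma extend_ord N (f : config N) (i : 'I_N.+1) :
  extend f i = (nat_of_ord (f i).1, (f i).2).
Proof. by rewrite /extend -ltnS ltn_ord inord_val. Qed.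

Lemma extend_inj N (f g : config N) : extend f =1 extend g -> f = g.
Proof.
move=> H; apply/ffunP => i; have := H i; rewrite !extend_ord.
by case: (f i) (g i) => [k b] [k' b'] /= [/val_inj-> ->].
Qed.

Lemma extend_smallest N (f : config N) :
  [exists s, has_smallest f s] <->
  exists s, 0 < s /\ forall i, allowed s i (extend f i).1 (extend f i).2.
Proof.
split=> [/existsP[s /andP[s0 /forallP H]]|[s [s0 H]]].
  exists (nat_of_ord s); split=> // i; case: (leqP i N) => Hi.
    by have := H (inord i); rewrite inordK // /extend Hi.
  have Hs : s < i by rewrite (leq_trans (ltn_ord s)).
  by rewrite /extend leqNgt Hi /allowed /= ltnNge ltnW //= gtn_eqF.
have HsN : s <= N.
  rewrite leqNgt; apply/negP => Hs; have := H s.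
  by rewrite /extend leqNgt Hs /allowed ltnn eqxx.
apply/existsP; exists (inord s); rewrite /has_smallest inordK // s0.
by apply/forallP => i; have := H i; rewrite extend_ord.
Qed.

Lemma extend_weight N (f : config N) L :
  N <= L -> weight f = \sum_(i < L.+1) i * (extend f i).1.
Proof.
move=> HL; rewrite /weight.
transitivity (\sum_(i < N.+1) i * (extend f i).1).
  by apply: eq_bigr => i _; rewrite extend_ord.
rewrite (@big_ord_widen _ _ _ N.+1 L.+1 (fun i => i * (extend f i).1)) // big_mkcond.
by apply: eq_bigr => i _; case: ltnP => // Hi; rewrite /extend leqNgt Hi muln0.
Qed.

(** A part times its multiplicity is at most the weight. This says nothing at index 0, where
    [allowed] forces multiplicity 0. *)
Lemma extend_bounds N n (f : config N) : f \in configs N n ->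
  (forall i, n < i -> extend f i = (0, false)) /\ forall i, (extend f i).1 <= n.
Proof.
rewrite inE => /andP[/extend_smallest[s [s0 Hs]] /eqP Hw].
have Hle i : i * (extend f i).1 <= n.
  case: (leqP i N) => Hi; last by rewrite /extend (leqNgt i) Hi muln0.
  rewrite -Hw (extend_weight f (leqnn N)).
  by rewrite (bigD1 (inord i : 'I_N.+1)) //= inordK // leq_addr.
split=> i => [Hi|].
  have := Hle i; have := Hs i; case: (extend f i) => [[|k] []] //=; last by nia.
    by rewrite /allowed; case: ltnP => //; case: eqP.
  by nia.
case: (posnP i) => [->|i0]; last by apply: leq_trans (Hle i); rewrite leq_pmull.
by have := Hs 0; rewrite /allowed s0 => /andP[/eqP->].
Qed.

(** Weight [n] confines parts and multiplicities to at most [n], so copying a configuration into box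
    [b] loses nothing, even if [b < a]. This yields both the bound and the stabilization of box
    counts. *)
Lemma card_configs_le (a b n : nat) : n <= b -> #|configs a n| <= #|configs b n|.
Proof.
move=> Hnb.
pose rho (f : config a) : config b :=
  [ffun i : 'I_b.+1 => (inord (extend f i).1, (extend f i).2)].
have Hrho f : f \in configs a n -> extend (rho f) =1 extend f.
  move=> /extend_bounds[Hz Hle] i; rewrite {1}/extend; case: leqP => Hi.
    by rewrite ffunE /= !inordK ?ltnS ?(leq_trans (Hle _)) //; case: (extend f i).
  by rewrite Hz // (leq_ltn_trans Hnb).
rewrite -(card_in_imset (f := rho)); last first.
  by move=> f g Hf Hg E; apply: extend_inj => i; rewrite -Hrho // -(Hrho g) // E.
apply: subset_leq_card; apply/subsetP => _ /imsetP[f Hf ->].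
have E := Hrho f Hf; move: Hf; rewrite !inE => /andP[/extend_smallest[s [s0 Hs]] /eqP Hw].
apply/andP; split.
  by apply/extend_smallest; exists s; split=> // i; rewrite E.
(* Both weights are rewritten as sums over one common range, where the extensions agree. *)
rewrite (extend_weight (rho f) (leq_maxr a b)) -Hw (extend_weight f (leq_maxl a b)).
by apply/eqP; apply: eq_bigr => i _; rewrite E.
Qed.

(** [phi] and [psi] are inverse: they merge and split the multiplicity and the overlining flag of
    each part. The global conditions then match the partwise ones. *)
Lemma pbar_omega_configs n : pbar_omega n = #|configs n n|.
Proof.
pose phi (p : {ffun 'I_n.+1 -> 'I_n.+1} * {set 'I_n.+1}) : config n :=
  [ffun i => (p.1 i, i \in p.2)].
pose psi (f : config n) : {ffun 'I_n.+1 -> 'I_n.+1} * {set 'I_n.+1} :=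
  ([ffun i => (f i).1], [set i | (f i).2]).
have phiK : cancel phi psi.
  move=> [m S]; rewrite /psi; congr pair; [apply/ffunP|apply/setP] => i;
  by rewrite ?inE !ffunE.
have psiK : cancel psi phi.
  move=> f; apply/ffunP => i; rewrite !ffunE inE /=; by case: (f i).
rewrite /pbar_omega -(on_card_preimset (f := phi) (R := configs n n)); last first.
  by apply: onW_bij; exists psi.
apply: eq_card => -[m S]; rewrite !inE /is_pbar_omega.
have -> : weight (phi (m, S)) = \sum_(i < n.+1) i * m i.
  by apply: eq_bigr => i _; rewrite ffunE.
rewrite [RHS]andbC; congr andb.
apply/idP/existsP.
- move=> /and3P[/eqP m0 /subsetP HS /existsP[s /and4P[ms sS]]].
  move=> /forallP Hmin /forallP Hodd.
  have s0 : 0 < s.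
    by case: posnP => // E; move: ms; rewrite (_ : s = ord0) ?m0 //; apply: val_inj.
  exists s; rewrite /has_smallest s0; apply/forallP => i; rewrite ffunE /= /allowed.
  case: ltngtP => [lt_is|lt_si|/val_inj->].
  + have mi0 : m i = 0 :> nat.
      by apply/eqP; rewrite -leqn0 leqNgt; apply/negP => Hm; have := Hmin i; rewrite Hm leqNgt lt_is.
    by rewrite mi0 /=; apply/negP => /HS; rewrite inE mi0.
  + by rewrite Hodd andbT; apply/implyP => /HS; rewrite inE.
  + by rewrite ms.
- move=> [s /andP[s0 /forallP H]].
have {}H (i : 'I_n.+1) : allowed s i (m i) (i \in S) by have := H i; rewrite ffunE.
have /andP[ms sS] : (0 < m s) && (s \in S) by have := H s; rewrite /allowed ltnn eqxx.
apply/and3P; split.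
  + by have := H ord0; rewrite /allowed s0 => /andP[].
  + apply/subsetP => i iS; rewrite inE; have := H i; rewrite /allowed iS andbF andbT /=.
  by case: ifP => // _; case: ifP => // _ /andP[].
  + apply/existsP; exists s; rewrite ms sS /=; apply/andP; split; apply/forallP => i.
    apply/implyP => mi; rewrite leqNgt; apply/negP => lt_is; have := H i.
    by rewrite /allowed lt_is => /andP[/eqP E]; rewrite E in mi.
  apply/implyP => /andP[mi oi]; have := H i; rewrite /allowed.
  case: ltngtP => [lt_is _|lt_si|/val_inj-> _].
    * by lia.
    * by rewrite mi oi /= => /andP[].
    * by lia.
Qed.

(** * Factors of the box generating function *)

Lemma overlinings_lt s i k : i < s -> overlinings s i k = (k == 0).
Proof. by rewrite /overlinings /allowed => ->; case: k. Qed.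

Lemma overlinings_eq s k : overlinings s s k = (0 < k).
Proof. by rewrite /overlinings /allowed ltnn eqxx; case: k. Qed.

Lemma overlinings_gt s i k : s < i ->
  overlinings s i k = if k is 0 then 1 else if ~~ odd i || (i < 2 * s) then 2 else 0.
Proof.
move=> lt_si; rewrite /overlinings /allowed ltnNge ltnW //= gtn_eqF //.
by case: k => //= k; case: odd; case: ltnP.
Qed.

Definition truncated_geom (N : nat) (z : C) : C :=
  sum_n (fun k => if k is 0 then RtoC 0 else Cpow z k) N.

Definition unrestricted (s i : nat) : bool := (s < i) && (~~ odd i || (i < 2 * s)).

(** Truncation of (1 + q^i)/(1 - q^i). At i = s the value is 1, since the smallest part contributes
    the separate factor [truncated_geom N (q ^ s)]. *)
Definition box_factor (q : C) (N s i : nat) : C :=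
  if unrestricted s i
  then Cplus (RtoC 1) (Cmult (RtoC 2) (truncated_geom N (Cpow q i))) else RtoC 1.

Lemma sum_n_indicator0 N : sum_n (fun k => if k is 0 then RtoC 1 else RtoC 0) N = RtoC 1.
Proof.
elim: N => [|N IH]; first by rewrite sum_O.
by rewrite sum_Sn IH; apply: Cplus_0_r.
Qed.

Lemma sum_n_indicator0_affine (c : C) (u : nat -> C) N :
  sum_n (fun k => Cplus (if k is 0 then RtoC 1 else RtoC 0) (Cmult c (u k))) N
  = Cplus (RtoC 1) (Cmult c (sum_n u N)).
Proof.
elim: N => [|N IH]; first by rewrite !sum_O.
by rewrite !sum_Sn IH /plus /=; ring.
Qed.

Lemma Csum_ext (u v : nat -> C) N :
  (forall k, u k = v k) -> sum_n u N = sum_n v N :> C.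
Proof. by move=> H; apply: (@sum_n_ext C_AbelianMonoid). Qed.

Lemma sum_overlinings (q : C) (N s i : nat) : i != s ->
  sum_n (fun k => Cmult (RtoC (INR (overlinings s i k))) (Cpow q (i * k))) N
  = box_factor q N s i.
Proof.
rewrite /box_factor /unrestricted neq_ltn => /orP[lt_is|lt_si].
  rewrite ltnNge ltnW //= -[RHS](sum_n_indicator0 N).
  apply: Csum_ext => -[|k]; rewrite overlinings_lt //=.
    by rewrite muln0 Cmult_1_l.
  by rewrite Cmult_0_l.
rewrite lt_si /=; case: ifP => Hgood.
  rewrite /truncated_geom -sum_n_indicator0_affine.
  apply: Csum_ext => -[|k]; rewrite overlinings_gt // ?Hgood.
    by rewrite muln0 /=; ring.
  rewrite Cpow_mult_r -[INR 2]/(IZR 2) /=; ring.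
rewrite -[RHS](sum_n_indicator0 N).
apply: Csum_ext => -[|k]; rewrite overlinings_gt // ?Hgood /=.
  by rewrite muln0 Cmult_1_l.
by rewrite Cmult_0_l.
Qed.

Lemma sum_overlinings_smallest (q : C) (N s : nat) :
  sum_n (fun k => Cmult (RtoC (INR (overlinings s s k))) (Cpow q (s * k))) N
  = truncated_geom N (Cpow q s).
Proof.
apply: Csum_ext => -[|k]; rewrite overlinings_eq /=; first by rewrite Cmult_0_l.
by rewrite Cpow_mult_r Cmult_1_l.
Qed.

Lemma box_product (q : C) (N s : nat) : s <= N ->
  cprod (fun i => sum_n (fun k =>
    Cmult (RtoC (INR (overlinings s i k))) (Cpow q (i * k))) N) N.+1
  = Cmult (truncated_geom N (Cpow q s)) (cprod (box_factor q N s) N.+1).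
Proof.
move=> Hs; rewrite -!big_cprod.
rewrite (bigD1 (inord s : 'I_N.+1)) //= inordK // sum_overlinings_smallest.
congr Cmult; rewrite [RHS](bigD1 (inord s : 'I_N.+1)) //= inordK //.
have -> : box_factor q N s s = RtoC 1 by rewrite /box_factor /unrestricted ltnn.
rewrite Cmult_1_l.
apply: eq_bigr => i Hi; apply: sum_overlinings.
by apply: contra Hi => /eqP<-; rewrite inord_val.
Qed.

Definition box_count (N n : nat) : nat := #|configs N n|.

Lemma box_count_le (N n : nat) : Rle (INR (box_count N n)) (INR (pbar_omega n)).
Proof.
by apply: le_INR; apply/leP; rewrite pbar_omega_configs; apply: card_configs_le.
Qed.

Lemma box_count_stable (N n : nat) : (n <= N)%coq_nat -> box_count N n = pbar_omega n.
Proof.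
move=> /leP H; apply/eqP.
by rewrite eqn_leq pbar_omega_configs !card_configs_le.
Qed.

Lemma box_series (q : C) (N : nat) :
  sum_n (fun s => if s is 0 then RtoC 0 else
    Cmult (truncated_geom N (Cpow q s)) (cprod (box_factor q N s) N.+1)) N
  = sum_n (fun n => Cmult (RtoC (INR (box_count N n))) (Cpow q n)) (N * (N * N.+1)).
Proof.
rewrite -box_generating_function; apply: sum_n_ext_loc => -[|s] Hs //.
by rewrite box_product //; apply/leP.
Qed.

Lemma unrestricted_le s i : (i <= s)%coq_nat -> unrestricted s i = false.
Proof. by move=> /leP H; rewrite /unrestricted ltnNge H. Qed.

(** An odd part at most 2s lies below 2s because 2s is even. *)
Lemma unrestricted_between s i :
  (s < i)%coq_nat -> (i <= 2 * s)%coq_nat -> unrestricted s i = true.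
Proof.
move=> /ltP H1 /leP; rewrite /unrestricted H1 leq_eqVlt => /orP[/eqP->|->].
  by rewrite mul2n odd_double.
exact: orbT.
Qed.

Lemma unrestricted_even s j : (s <= j)%coq_nat -> unrestricted s (2 * j.+1) = true.
Proof.
move=> /leP H; rewrite /unrestricted mul2n odd_double andbT.
by rewrite -addnn; lia.
Qed.

Lemma unrestricted_odd s j : (s <= j)%coq_nat -> unrestricted s (2 * j).+1 = false.
Proof.
move=> /leP H; have E : ((2 * j).+1 < 2 * s) = false by lia.
by rewrite /unrestricted E /= mul2n odd_double andbF.
Qed.

End OverpartitionCount.

Import OverpartitionCount.

(** * Limits of the box generating functions *)

Lemma truncated_geom_eq (N : nat) (z : C) :
  1 - z <> 0 -> truncated_geom N z = (z - z ^ S N) / (1 - z).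
Proof.
intros Hz. unfold truncated_geom. induction N as [|N IH].
- rewrite sum_O. simpl. field. exact Hz.
- rewrite sum_Sn, IH.
  change ((z - z ^ S N) / (1 - z) + z ^ S N = (z - z ^ S (S N)) / (1 - z)).
  rewrite (Cpow_S z (S N)). field. exact Hz.
Qed.

Lemma truncated_geom_lim (z : C) :
  (Cmod z < 1)%R -> Clim (fun N => truncated_geom N z) (z / (1 - z)).
Proof.
intros Hz. assert (H1 := one_minus_neq0 z Hz).
apply Clim_ext with (u := fun N => (z + - z * z ^ N) * / (1 - z)).
- intros N. rewrite truncated_geom_eq by exact H1. rewrite Cpow_S.
  field. exact H1.
- replace (z / (1 - z)) with ((z + - z * 0) * / (1 - z)) by (field; exact H1).
  apply Clim_mult; [|apply Clim_const].
  apply Clim_plus; [apply Clim_const|].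
  apply Clim_mult; [apply Clim_const|now apply Clim_pow0].
Qed.

Lemma truncated_geom_bound (q : C) (N i : nat) :
  (Cmod q < 1)%R -> i <> O ->
  (Cmod (truncated_geom N (q ^ i)) <= 2 / (1 - Cmod q) * Cmod q ^ i)%R.
Proof.
intros Hq Hi. destruct i as [|i]; [easy|].
assert (Hz := Cmod_pow_lt1 q i Hq). rewrite <- Cmod_pow.
set (z := q ^ S i) in *.
assert (H1 := one_minus_neq0 z Hz).
rewrite truncated_geom_eq by exact H1.
replace ((z - z ^ S N) / (1 - z)) with (/ (1 - z) * z * (1 + - z ^ N))
  by (rewrite Cpow_S; field; exact H1).
rewrite !Cmod_mult, Cmod_inv by exact H1.
assert (Hz0 := Cmod_ge_0 z).
assert (Hzq : (Cmod z <= Cmod q)%R).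
{ unfold z. rewrite Cpow_S, Cmod_mult.
  assert (H2 := Cmod_pow_le1 q i Hq). assert (H3 := Cmod_ge_0 q). nra. }
assert (Hlow : (1 - Cmod q <= Cmod (1 - z))%R).
{ assert (Ht := Cmod_triangle (1 - z) z).
  replace (1 - z + z) with (RtoC 1) in Ht by ring. rewrite Cmod_1 in Ht. lra. }
assert (Hnum : (Cmod (1 + - z ^ N) <= 2)%R).
{ assert (Ht := Cmod_triangle 1 (- z ^ N)). rewrite Cmod_opp, Cmod_1 in Ht.
  assert (H2 := Cmod_pow_le1 z N Hz). lra. }
assert (Hinv : (/ Cmod (1 - z) <= / (1 - Cmod q))%R)
  by (apply Rinv_le_contravar; lra).
assert (Hinv0 : (0 <= / Cmod (1 - z))%R)
  by (apply Rlt_le, Rinv_0_lt_compat; lra).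
replace (2 / (1 - Cmod q) * Cmod z)%R with (/ (1 - Cmod q) * Cmod z * 2)%R
  by (field; lra).
apply Rmult_le_compat; [now apply Rmult_le_pos|apply Cmod_ge_0| |exact Hnum].
now apply Rmult_le_compat_r.
Qed.

Definition part_factor (q : C) (s i : nat) : C :=
  if unrestricted s i then (1 + q ^ i) / (1 - q ^ i) else 1.

Lemma unrestricted_neq0 (s i : nat) : unrestricted s i = true -> i <> O.
Proof.
intros H ->. rewrite unrestricted_le in H; [discriminate|lia].
Qed.

(** Uniformity in [N] and [s] is what both applications of Tannery's theorem require. *)
Lemma box_factor_bound (q : C) (N s i : nat) :
  (Cmod q < 1)%R ->
  (Cmod (box_factor q N s i - 1) <= 4 / (1 - Cmod q) * Cmod q ^ i)%R.
Proof.
intros Hq. unfold box_factor. destruct (unrestricted s i) eqn:E.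
- replace (1 + 2 * truncated_geom N (q ^ i) - 1)
    with (2 * truncated_geom N (q ^ i)) by ring.
  assert (H := truncated_geom_bound q N i Hq (unrestricted_neq0 s i E)).
  rewrite Cmod_mult, Cmod_R, Rabs_pos_eq by lra.
  replace (4 / (1 - Cmod q) * Cmod q ^ i)%R
    with (2 * (2 / (1 - Cmod q) * Cmod q ^ i))%R by (field; lra).
  lra.
- replace (1 - 1) with (RtoC 0) by ring. rewrite Cmod_0.
  apply Rmult_le_pos; [|apply pow_le, Cmod_ge_0].
  apply Rlt_le, Rdiv_lt_0_compat; lra.
Qed.

Lemma box_factor_lim (q : C) (s i : nat) :
  (Cmod q < 1)%R -> Clim (fun N => box_factor q N s i) (part_factor q s i).
Proof.
intros Hq. unfold box_factor, part_factor. destruct (unrestricted s i) eqn:E.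
- assert (Hi := unrestricted_neq0 s i E). destruct i as [|i]; [easy|].
  assert (Hz := Cmod_pow_lt1 q i Hq). assert (H1 := one_minus_neq0 _ Hz).
  replace ((1 + q ^ S i) / (1 - q ^ S i)) with (1 + 2 * (q ^ S i / (1 - q ^ S i)))
    by (field; exact H1).
  apply Clim_plus; [apply Clim_const|].
  apply Clim_mult; [apply Clim_const|now apply truncated_geom_lim].
- apply Clim_const.
Qed.

Lemma part_product_low (q : C) (s n : nat) :
  (n <= S s)%nat -> cprod (part_factor q s) n = 1.
Proof.
induction n as [|n IH]; intros Hn; [easy|]. simpl.
rewrite IH by lia. unfold part_factor. rewrite unrestricted_le by lia. ring.
Qed.

Lemma part_product_mid (q : C) (s k : nat) :
  (Cmod q < 1)%R -> (k <= s)%nat ->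
  cprod (part_factor q s) (S (s + k))
  = qpoch (- q) q (s + k) * qpoch q q s / (qpoch q q (s + k) * qpoch (- q) q s).
Proof.
intros Hq. assert (Hmq := Cmod_opp_lt1 q Hq).
assert (Ha := qpoch_neq0 q q s Hq Hq). assert (Hb := qpoch_neq0 (- q) q s Hmq Hq).
induction k as [|k IH]; intros Hk.
- rewrite Nat.add_0_r, part_product_low by lia. field. now split.
- rewrite Nat.add_succ_r.
  change (cprod (part_factor q s) (S (S (s + k))))
    with (cprod (part_factor q s) (S (s + k)) * part_factor q s (S (s + k))).
  rewrite IH by lia. unfold part_factor. rewrite unrestricted_between by lia.
  cbn [qpoch]. rewrite Cpow_S.
  replace (1 - - q * q ^ (s + k)) with (1 + q * q ^ (s + k)) by ring.
  assert (Hc := qpoch_neq0 q q (s + k) Hq Hq).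
  assert (Hd := one_minus_neq0 _ (Cmod_mul_pow_lt1 q q (s + k) Hq Hq)).
  field. now repeat split.
Qed.

(** All parts from s + 1 to 2s contribute, and beyond 2s only even ones. The base case splits the
    products of length 2s into base q^2; each step adds a trivial odd factor and one even factor. *)
Lemma part_product_high (q : C) (s j : nat) :
  (Cmod q < 1)%R ->
  cprod (part_factor q s) (S (2 * (s + j)))
  = qpoch (- q) (q ^ 2) s * qpoch q q s / (qpoch q (q ^ 2) s * qpoch (- q) q s)
    * (qpoch (- q ^ 2) (q ^ 2) (s + j) / qpoch (q ^ 2) (q ^ 2) (s + j)).
Proof.
intros Hq. assert (Hmq := Cmod_opp_lt1 q Hq).
assert (Hq2 := Cmod_pow_lt1 q 1 Hq). assert (Hmq2 := Cmod_opp_lt1 _ Hq2).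
assert (Ha := qpoch_neq0 q q s Hq Hq). assert (Hb := qpoch_neq0 (- q) q s Hmq Hq).
assert (Hc := qpoch_neq0 q (q ^ 2) s Hq Hq2).
induction j as [|j IH].
- rewrite Nat.add_0_r. replace (2 * s)%nat with (s + s)%nat by lia.
  rewrite part_product_mid by trivial.
  replace (s + s)%nat with (2 * s)%nat by lia. rewrite !qpoch_double.
  replace (q * q) with (q ^ 2) by ring. replace (- q * q) with (- q ^ 2) by ring.
  assert (Hd := qpoch_neq0 (q ^ 2) (q ^ 2) s Hq2 Hq2).
  field. now repeat split.
- rewrite Nat.add_succ_r. set (n := (s + j)%nat) in *.
  replace (S (2 * S n)) with (S (S (S (2 * n)))) by lia.
  change (cprod (part_factor q s) (S (S (S (2 * n)))))
    with (cprod (part_factor q s) (S (2 * n)) * part_factor q s (S (2 * n))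
          * part_factor q s (S (S (2 * n)))).
  rewrite IH. replace (S (S (2 * n))) with (2 * S n)%nat by lia.
  unfold part_factor.
  rewrite unrestricted_odd by lia. rewrite unrestricted_even by lia.
  rewrite (Cpow_mult_r q 2 (S n)), (Cpow_S (q ^ 2) n). cbn [qpoch].
  replace (1 - - q ^ 2 * (q ^ 2) ^ n) with (1 + q ^ 2 * (q ^ 2) ^ n) by ring.
  assert (Hd := qpoch_neq0 (q ^ 2) (q ^ 2) n Hq2 Hq2).
  assert (He := one_minus_neq0 _ (Cmod_mul_pow_lt1 (q ^ 2) (q ^ 2) n Hq2 Hq2)).
  field. now repeat split.
Qed.

Definition smallest_part_term (q : C) (l : nat -> C) (s : nat) : C :=
  match s with O => 0 | _ => q ^ s / (1 - q ^ s) * l s end.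

(** Tannery's theorem is used for the product at each fixed [s], then for the sum over [s]. *)
Lemma box_series_lim (q : C) :
  (Cmod q < 1)%R ->
  exists (l : nat -> C) (G : C),
    (forall s, Clim (cprod (part_factor q s)) (l s)) /\
    is_series (smallest_part_term q l) G /\
    Clim (fun N => sum_n (fun n => INR (box_count N n) * q ^ n) (N * (N * S N))) G.
Proof.
intros Hq.
assert (Hr : (0 <= Cmod q < 1)%R) by (split; [apply Cmod_ge_0|exact Hq]).
assert (HK : (0 <= 4 / (1 - Cmod q))%R) by (apply Rlt_le, Rdiv_lt_0_compat; lra).
assert (Hex : forall s, exists l, Clim (cprod (part_factor q s)) l /\
  Clim (fun N => cprod (box_factor q N s) (S N)) l).
{ intros s. apply (tannery_prod (fun N => box_factor q N s) _ (fun N => N)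
    (4 / (1 - Cmod q)) (Cmod q) Hr HK).
  - intros N. lia.
  - intros N i _. now apply box_factor_bound.
  - intros i. now apply box_factor_lim. }
destruct (functional_choice _ Hex) as [l Hl]. exists l.
(* In the majorant, 2/(1-|q|) comes from the smallest part, and the exponential bounds the product
   uniformly in [N] and [s]. *)
destruct (tannery_sum (fun N s => match s with O => RtoC 0 | S _ =>
    truncated_geom N (q ^ s) * cprod (box_factor q N s) (S N) end)
    (smallest_part_term q l) (fun N => N)
    (2 / (1 - Cmod q) * exp (4 / (1 - Cmod q) / (1 - Cmod q))) (Cmod q) Hr)
  as [G [HG1 HG2]].
- intros N. lia.
- intros N s _. set (E := exp _).
  assert (HE : (0 < E)%R) by apply exp_pos.
  replace (2 / (1 - Cmod q) * E * Cmod q ^ s)%R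
    with (2 / (1 - Cmod q) * Cmod q ^ s * E)%R by ring.
  destruct s as [|s].
  + rewrite Cmod_0. apply Rmult_le_pos; [|lra].
    apply Rmult_le_pos; [apply Rlt_le, Rdiv_lt_0_compat; lra|now apply pow_le].
  + rewrite Cmod_mult. apply Rmult_le_compat; try apply Cmod_ge_0.
    * apply truncated_geom_bound; [exact Hq|lia].
    * apply cprod_bound_exp; [exact Hr| |exact HK].
      intros i _. now apply box_factor_bound.
- intros [|s]; [apply Clim_const|]. apply Clim_mult; [|apply Hl].
  now apply truncated_geom_lim, Cmod_pow_lt1.
- exists G. split; [intros s; apply Hl|]. split; [exact HG1|].
  eapply Clim_ext; [|exact HG2]. intros N. exact (box_series q N).
Qed.

(** * Convergence and value of the overpartition series *)

Lemma sum_n_RtoC (a : nat -> R) (n : nat) :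
  sum_n (fun k => RtoC (a k)) n = RtoC (sum_n a n).
Proof.
induction n as [|n IH]; [now rewrite !sum_O|].
rewrite !sum_Sn, IH. symmetry. apply RtoC_plus.
Qed.

Lemma sum_n_ge_term (a : nat -> R) (n i : nat) :
  (forall k, (0 <= a k)%R) -> (i <= n)%nat -> (a i <= sum_n a n)%R.
Proof.
intros H Hi. induction Hi as [|n Hi IH].
- destruct i as [|i]; [rewrite sum_O; lra|]. rewrite sum_Sn.
  assert (Hs : (0 <= sum_n a i)%R).
  { induction i as [|i IH]; [rewrite sum_O; apply H|].
    rewrite sum_Sn. apply Rplus_le_le_0_compat; [exact IH|apply H]. }
  change (a (S i) <= sum_n a i + a (S i))%R. lra.
- rewrite sum_Sn. specialize (H (S n)).
  change (a i <= sum_n a n + a (S n))%R. lra.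
Qed.

(** The term of index n already appears in full in the box of size n. As all terms are nonnegative,
    it is at most the whole box sum, and the box sums converge. *)
Lemma pbar_omega_bound (x : R) :
  (0 < x < 1)%R ->
  exists B, (0 < B)%R /\ forall n, (INR (pbar_omega n) * x ^ n <= B)%R.
Proof.
intros Hx. assert (Hq : (Cmod x < 1)%R) by (rewrite Cmod_R, Rabs_pos_eq; lra).
destruct (box_series_lim x Hq) as [l [G [_ [_ HG]]]].
destruct (Clim_bounded _ _ HG) as [B [HB H]].
exists B. split; [exact HB|]. intros n. eapply Rle_trans; [|apply (H n)].
set (a := fun k => (INR (box_count n k) * x ^ k)%R).
assert (Ha : forall k, (0 <= a k)%R).
{ intros k. apply Rmult_le_pos; [apply pos_INR|apply pow_le; lra]. }
assert (Hn : (n <= n * (n * S n))%nat) by nia.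
assert (H1 := sum_n_ge_term a _ n Ha Hn).
replace (sum_n (fun k => INR (box_count n k) * x ^ k) (n * (n * S n)))
  with (RtoC (sum_n a (n * (n * S n)))).
- rewrite Cmod_R. eapply Rle_trans; [|apply Rle_abs].
  unfold a in H1 at 1. rewrite box_count_stable in H1 by lia. exact H1.
- rewrite <- sum_n_RtoC. apply (@sum_n_ext C_AbelianMonoid). intros k.
  unfold a. now rewrite RtoC_mult, RtoC_pow.
Qed.

Lemma pbar_omega_series (q Q D : C) :
  (0 < Cmod q)%R -> (Cmod q < 1)%R ->
  is_qpoch_inf (- q ^ 2) (q ^ 2) Q -> is_qpoch_inf (q ^ 2) (q ^ 2) D ->
  exists G : C,
    is_series (fun n => INR (pbar_omega n) * q ^ n) G /\
    is_series (fun n => Q / D * (q ^ S n * qpoch (- q) (q ^ 2) (S n) * qpoch q q n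
                        / (qpoch q (q ^ 2) (S n) * qpoch (- q) q (S n)))) G.
Proof.
intros Hq0 Hq HQ HD.
assert (Hmq := Cmod_opp_lt1 q Hq).
assert (Hq2 := Cmod_pow_lt1 q 1 Hq). assert (Hmq2 := Cmod_opp_lt1 _ Hq2).
destruct (box_series_lim q Hq) as [l [G [Hl [HG1 HG2]]]].
exists G. split.
(* A point strictly between |q| and 1 turns the bound at [x] into a geometric majorant of ratio
   |q|/x for the box coefficients. *)
- set (x := ((Cmod q + 1) / 2)%R).
  assert (Hx : (0 < x < 1)%R) by (unfold x; lra).
  destruct (pbar_omega_bound x Hx) as [B [HB HBn]].
  assert (Hqx : (0 <= Cmod q / x < 1)%R).
  { split; [apply Rlt_le, Rdiv_lt_0_compat; lra|].
    apply Rmult_lt_reg_r with x; [lra|].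
    unfold Rdiv. rewrite Rmult_assoc, Rinv_l by lra. unfold x. lra. }
  destruct (tannery_sum (fun N n => INR (box_count N n) * q ^ n)
    (fun n => INR (pbar_omega n) * q ^ n) (fun N => (N * (N * S N))%nat)
    B (Cmod q / x) Hqx) as [G' [HG1' HG2']].
  + intros N. nia.
  + intros N n _. rewrite Cmod_mult, Cmod_R, Cmod_pow, Rabs_pos_eq by apply pos_INR.
    replace (Cmod q ^ n)%R with (x ^ n * (Cmod q / x) ^ n)%R
      by (rewrite <- Rpow_mult_distr; f_equal; field; lra).
    rewrite <- Rmult_assoc. apply Rmult_le_compat_r; [apply pow_le; lra|].
    eapply Rle_trans; [|apply (HBn n)].
    apply Rmult_le_compat_r; [apply pow_le; lra|apply box_count_le].
  + intros n. apply Clim_eventually_ext with (2 := Clim_const (INR (pbar_omega n) * q ^ n))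
      (N := n).
    intros N HN. now rewrite box_count_stable.
  + now rewrite (Clim_unique _ _ _ HG2 HG2').
- eapply is_series_Ceq; [| |exact (proj1 (is_series_Cshift _ _) HG1)].
  + intros n. set (s := S n).
    assert (E : l s = qpoch (- q) (q ^ 2) s * qpoch q q s
                      / (qpoch q (q ^ 2) s * qpoch (- q) q s) * (Q / D)).
    (* The product is evaluated along the lengths 2(s+j)+1, where its closed form is available. *)
    { apply (Clim_unique (fun j => cprod (part_factor q s) (S (2 * (s + j))))).
      - apply (Clim_subseq (cprod (part_factor q s)) _ (fun j => S (2 * (s + j))));
          [intros; lia|apply Hl].
      - eapply Clim_ext; [intros j; symmetry; now apply part_product_high|].
        apply Clim_mult; [apply Clim_const|].
        apply (Clim_mult (fun j => qpoch (- q ^ 2) (q ^ 2) (s + j))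
                 (fun j => / qpoch (q ^ 2) (q ^ 2) (s + j))).
        + apply (Clim_subseq (qpoch (- q ^ 2) (q ^ 2)) _ (fun j => (s + j)%nat));
            [intros; lia|exact HQ].
        + apply (Clim_subseq (fun j => / qpoch (q ^ 2) (q ^ 2) j) _ (fun j => (s + j)%nat));
            [intros; lia|exact (proj2 (qpoch_inf_inv _ _ _ Hq2 Hq2 HD))]. }
    unfold smallest_part_term, s at 1. fold s. rewrite E.
    assert (HD0 := proj1 (qpoch_inf_inv _ _ _ Hq2 Hq2 HD)).
    assert (Ha := qpoch_neq0 q (q ^ 2) s Hq Hq2).
    assert (Hb := qpoch_neq0 (- q) q s Hmq Hq).
    assert (Hc := one_minus_neq0 _ (Cmod_pow_lt1 q n Hq)). fold s in Hc.
    (* The last factor cancels the denominator 1 - q^s of the smallest part. *)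
    change (qpoch q q s) with (qpoch q q n * (1 - q ^ s)).
    field. now repeat split.
  + simpl. ring.
Qed.

(** * Normalization of the constants in the two identities *)

Theorem theorem1p2 (q : C) (hq0 : (0 < Cmod q)%R) (hq1 : (Cmod q < 1)%R) :
  (exists (L S2 S3 Pq Pmq Pmq2 Pq32 : C),
     is_series (fun n => q ^ n * qpoch (- q ^ 3) (q ^ 2) n * qpoch q q n
                         / (qpoch (q ^ 3) (q ^ 2) n * qpoch (- q ^ 2) q n)) L /\
     is_series (fun n => qpoch (-1) q n * qpoch (- q) (q ^ 2) n
                         / (qpoch q (q ^ 2) n * qpoch q q n) * q ^ n) S2 /\
     is_series (fun n => qpoch q (q ^ 2) n * (- q) ^ n
                         / (qpoch (- q) (q ^ 2) n * (1 + q ^ (2 * n)))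
                         * little_qJacobi (2 * n) (-1) (/ q ^ (2 * n + 1)) (-1) q) S3 /\
     is_qpoch_inf q q Pq /\ is_qpoch_inf (- q) q Pmq /\
     is_qpoch_inf (- q) (q ^ 2) Pmq2 /\ is_qpoch_inf (q ^ 3) (q ^ 2) Pq32 /\
     L = / 2 * (1 - / q) * (Pq ^ 2 / Pmq ^ 2) * S2
         + / q * (Pmq2 / Pq32) * S3) /\
  (exists (G S2 S3 Pq Pmq Pq2 Pmq2 : C),
     is_series (fun n => RtoC (INR (pbar_omega n)) * q ^ n) G /\
     is_series (fun n => qpoch (-1) q n * qpoch (- q) (q ^ 2) n
                         / (qpoch q (q ^ 2) n * qpoch q q n) * q ^ n) S2 /\
     is_series (fun n => qpoch q (q ^ 2) n * (- q) ^ n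
                         / (qpoch (- q) (q ^ 2) n * (1 + q ^ (2 * n)))
                         * little_qJacobi (2 * n) (-1) (/ q ^ (2 * n + 1)) (-1) q) S3 /\
     is_qpoch_inf q q Pq /\ is_qpoch_inf (- q) q Pmq /\
     is_qpoch_inf q (q ^ 2) Pq2 /\ is_qpoch_inf (- q) (q ^ 2) Pmq2 /\
     G = - / 2 * (Pq * Pq2 / (Pmq * Pmq2)) * S2 + Pmq / Pq * S3).
Proof.
assert (hq : q <> 0) by (intros H; rewrite H, Cmod_0 in hq0; lra).
assert (Hmq := Cmod_opp_lt1 q hq1). assert (Hq2 := Cmod_pow_lt1 q 1 hq1).
assert (Hmq2 := Cmod_opp_lt1 _ Hq2).
assert (Hq3 := Cmod_pow_lt1 q 2 hq1).
destruct (qpoch_inf_ex q q hq1) as [P HP].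
destruct (qpoch_inf_ex (- q) q hq1) as [M HM].
destruct (qpoch_inf_ex q (q ^ 2) Hq2) as [Po HPo].
destruct (qpoch_inf_ex (- q) (q ^ 2) Hq2) as [Mo HMo].
destruct (qpoch_inf_ex (q ^ 3) (q ^ 2) Hq2) as [P3 HP3].
destruct (qpoch_inf_ex (q ^ 2) (q ^ 2) Hq2) as [Pe HPe].
destruct (qpoch_inf_ex (- q ^ 2) (q ^ 2) Hq2) as [Me HMe].
assert (HM0 := proj1 (qpoch_inf_inv _ _ _ Hmq hq1 HM)).
assert (HPo0 := proj1 (qpoch_inf_inv _ _ _ hq1 Hq2 HPo)).
assert (HMo0 := proj1 (qpoch_inf_inv _ _ _ Hmq Hq2 HMo)).
assert (HP30 := proj1 (qpoch_inf_inv _ _ _ Hq3 Hq2 HP3)).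
assert (HPe0 := proj1 (qpoch_inf_inv _ _ _ Hq2 Hq2 HPe)).
assert (HMe0 := proj1 (qpoch_inf_inv _ _ _ Hmq2 Hq2 HMe)).
assert (E1 : Po = (1 - q) * P3).
{ rewrite (qpoch_inf_add q (q ^ 2) Po P3 1 HPo); [simpl; ring|].
  now replace (q * (q ^ 2) ^ 1) with (q ^ 3) by ring. }
assert (EP : P = Po * Pe).
{ apply (Clim_unique (qpoch q q) _ _ HP). apply qpoch_inf_double; trivial.
  now replace (q * q) with (q ^ 2) by ring. }
assert (EM : M = Mo * Me).
{ apply (Clim_unique (qpoch (- q) q) _ _ HM). apply qpoch_inf_double; trivial.
  now replace (- q * q) with (- q ^ 2) by ring. }
assert (H1q := one_minus_neq0 q hq1). assert (H1pq := one_plus_neq0 q hq1).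
destruct (double_series_identity q P M Po Mo hq hq1 HP HM HPo HMo)
  as [F [S2 [S3 [HF [HS2 [HS3 E]]]]]].
split.
(* Removing the first factor of each product of length n + 1 leaves q/(1-q) times the stated term;
   the two factors 1 + q cancel. *)
- exists ((1 - q) / q * F), S2, S3, P, M, Mo, P3.
  split; [|repeat (split; [assumption|])].
  + eapply is_series_Ceq; [|reflexivity|exact (is_series_Cscal ((1 - q) / q) _ _ HF)].
    intros n. cbv beta. rewrite !(qpoch_succ_l _ (q ^ 2)), (qpoch_succ_l (- q) q), Cpow_S.
    replace (q * q ^ 2) with (q ^ 3) by ring.
    replace (- q * q ^ 2) with (- q ^ 3) by ring.
    replace (- q * q) with (- q ^ 2) by ring.
    replace (1 - - q) with (1 + q) by ring.
    assert (Ha := qpoch_neq0 (q ^ 3) (q ^ 2) n Hq3 Hq2).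
    assert (Hb := qpoch_neq0 (- q ^ 2) q n Hmq2 hq1).
    field. now repeat split.
  + rewrite E, E1. field. now repeat split.
- destruct (pbar_omega_series q Me Pe hq0 hq1 HMe HPe) as [G [HG1 HG2]].
  exists G, S2, S3, P, M, Po, Mo.
  repeat (split; [assumption|]).
  (* [G] is Me/Pe times [F]; the even-odd factorizations P = Po Pe and M = Mo Me bring the constants
     to the stated form. *)
  rewrite (is_series_Cunique _ _ _ HG2 (is_series_Cscal (Me / Pe) _ _ HF)), E, EP, EM.
  field. now repeat split.
Qed.
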